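(* If the Greuel--Lossen--Shustin conjecture (stated in the context) holds, then for every real $t\ge9$ a very general quasimonomial valuation $v(\xi,t)$ is minimal, i.e. $\hat\mu(\xi,t)=\sqrt t$ for very general $\xi$.
   Context: We work over $\mathbb{C}$. For $\xi\in\mathbb{C}[[x]]$ with $\xi(0)=0$ and real $t\ge 1$, the quasimonomial valuation $v(\xi,t)$ of $\mathbb{C}(x,y)$ is given on polynomials by $f\mapsto v(\xi,t;f)=\operatorname{ord}_x f(x,\xi(x)+\theta x^t)$, $\theta$ transcendental over $\mathbb{C}$; equivalently, if $f=\sum a_{ij}x^i(y-\xi(x))^j$, then $v(\xi,t;f)=\min\{i+tj\mid a_{ij}\ne0\}$. Put $\mu_d(\xi,t)=\max\{v(\xi,t;f)\mid 0\ne f\in\mathbb{C}[x,y],\ \deg f\le d\}$ and $\hat\mu(\xi,t)=\lim_{d\to\infty}\mu_d(\xi,t)/d$. A valuation $v$ centered at the origin is minimal if $\hat\mu(v)=1/\sqrt{\operatorname{vol}(v)}$; $\operatorname{vol}(v(\xi,t))=1/t$. Very general means: coefficients of (a jet of) $\xi$ outside a countable union of proper Zariski closed subsets. Clusters: a (finite) cluster on $\mathbb{P}^2$ is a finite sequence of points $p_1\in\mathbb{P}^2$, $p_2,\dots$, each infinitely near to the preceding ones (lying on the exceptional divisor of the blowup of the previous one); a weighted cluster carries an integer weight $m_p\geq 0$ at each point. A point $q$ is proximate to $p$ ($q\succ p$) if $q$ lies on the (proper transform of the) exceptional divisor of the blowup of $p$. Let $K$ be a finite union of weighted clusters satisfying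 the proximity inequalities $m_p\ge\sum_{q\succ p}m_q$ for all $p\in K$; let $\pi:S_K\to\mathbb{P}^2$ be the blowup of all points of $K$, $E_p$ the total transform of the exceptional divisor over $p$, and $\mathcal{H}_{K,m}=\pi_*\mathcal{O}_{S_K}(-\sum_{p\in K}m_pE_p)$. Greuel--Lossen--Shustin conjecture: let $K$ be a finite union of weighted clusters on the plane satisfying the proximity inequalities. Assume that $K$ is general among all clusters with the same proximities, and let $d$ be an integer larger than the sum of the three biggest multiplicities of $m$. Then $$h^0(\mathcal{H}_{K,m}(d))=\max\left\{0,\frac{(d+1)(d+2)}2-\sum_{p\in K}\frac{m_p(m_p+1)}2\right\}.$$ *)

(* Defs.v *)
(* The multinomials library has to be imported before the analysis one. *)
From mathcomp Require Import all_boot all_order all_algebra.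
From mathcomp Require Import complex mpoly.
From mathcomp Require Import boolp classical_sets reals.
From mathcomp Require Import topology normedtype sequences.

Set Implicit Arguments.
Unset Strict Implicit.
Unset Printing Implicit Defensive.

Import Order.TTheory GRing.Theory Num.Theory.
Import numFieldNormedType.Exports.

Local Open Scope ring_scope.
Local Open Scope classical_set_scope.

Section LinearAlgebra.
Variables (C : fieldType) (V : lmodType C).

Definition lincomb k (b : 'I_k -> V) (c : 'rV[C]_k) : V :=
  \sum_(i < k) c 0 i *: b i.

(* S is a linear subspace of V of dimension k *)
Definition has_dim (S : set V) (k : nat) : Prop :=
  exists b : 'I_k -> V, injective (lincomb b) /\ S = range (lincomb b).

(* for a linear subspace I, the quotient V / I has dimension k *)
Definition has_codim (I : set V) (k : nat) : Prop :=
  exists b : 'I_k -> V,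
    forall f, exists! c : 'rV[C]_k, I (f - lincomb b c).

(* dim V / I; the value is 0 when that dimension is infinite *)
Definition colength (I : set V) : nat := xget 0%N [set k | has_codim I k].

End LinearAlgebra.

Definition zariski_closed (C : comNzRingType) (N : nat)
    (Z : set ('I_N -> C)) : Prop :=
  exists S : set {mpoly C[N]}, Z = [set a | forall g, S g -> g.@[a] = 0].

Section Clusters.
Variable C : fieldType.

Notation poly2 := {mpoly C[2]}.
Notation varx := ('X_(0 : 'I_2) : poly2).
Notation vary := ('X_(1 : 'I_2) : poly2).

(* inl (a, b) is [1 : a : b], inr (Some b) is [0 : 1 : b], and inr None is
   [0 : 0 : 1]. *)
Definition pplane : Type := (C * C + option C)%type.

(* Affine coordinates (x, y) of the projective plane centered at b. *)
Definition plane_chart (b : pplane) : 3.-tuple poly2 :=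
  match b with
  | inl (a1, a2) => [tuple 1; varx + a1%:MP; vary + a2%:MP]
  | inr (Some a) => [tuple varx; 1; vary + a%:MP]
  | inr None => [tuple varx; vary; 1]
  end.

(* A point of the exceptional divisor of the blowup of the origin of a chart
   is a tangent direction at the origin: Some c is the line y = c x, None is
   the line x = 0.  The blowup has the coordinates (x', y') centered at that
   point given by (x, y) = (x', x' (y' + c)), respectively by
   (x, y) = (x' y', y'). *)
Definition direction : Type := option C.

Definition blowup_chart (c : direction) : 2.-tuple poly2 :=
  if c is Some c' then [tuple varx; varx * (vary + c'%:MP)]
  else [tuple varx * vary; vary].

(* The equation of the new exceptional divisor in these coordinates. *)
Definition exceptional (c : direction) : poly2 :=
  if c is Some _ then varx else vary.

(* The direction of the line (exceptional c). *)
Definition exceptional_dir (c : direction) : direction :=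
  if c is Some _ then None else Some 0.

(* (b, [:: c1; ...; ck]) is the point in the k-th infinitesimal neighbourhood
   of b obtained by following c1, ..., ck, each taken in the chart of the
   preceding point.  Every point equal or infinitely near to a point of the
   plane is represented exactly once. *)
Definition ipoint : Type := (pplane * seq direction)%type.

(* q is infinitely near to p, and q <> p *)
Definition precedes (p q : ipoint) : bool :=
  [&& p.1 == q.1, prefix p.2 q.2 & (size p.2 < size q.2)%N].

(* The proper transform of the line (exceptional c) passes through a point of
   the blowup only in the direction (exceptional_dir c), and there it has the
   same equation again. *)
Definition proximate (q p : ipoint) : bool :=
  precedes p q &&
  if drop (size p.2) q.2 is c :: r then all (pred1 (exceptional_dir c)) r
  else false.

Definition pullback (s : seq direction) (f : poly2) : poly2 :=
  foldl (fun g c => g \mPo blowup_chart c) f s.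

(* The pullback of a form to the chart centered at w. *)
Definition form_at (w : ipoint) (F : {mpoly C[3]}) : poly2 :=
  pullback w.2 (F \mPo plane_chart w.1).

(* The equation of the total transform E_p in the chart centered at w. *)
Definition total_exceptional (p w : ipoint) : poly2 :=
  if precedes p w then
    if drop (size p.2) w.2 is c :: r then pullback r (exceptional c) else 1
  else 1.

Section Families.
Variable n : nat.

(* The points of a finite union of clusters. *)
Definition is_clusters (K : 'I_n -> ipoint) : Prop :=
  injective K /\ forall j p, precedes p (K j) -> exists i, K i = p.

Definition same_proximities (K K' : 'I_n -> ipoint) : Prop :=
  forall i j, proximate (K i) (K j) = proximate (K' i) (K' j).

Definition proximity_inequalities (K : 'I_n -> ipoint) (m : 'I_n -> nat) :
  Prop := forall i, (\sum_(j < n | proximate (K j) (K i)) m j <= m i)%N.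

(* w is a point of the blowup S_K of the plane at all the points of K *)
Definition on_blowup (K : 'I_n -> ipoint) (w : ipoint) : Prop :=
  (forall i, K i <> w) /\ forall p, precedes p w -> exists i, K i = p.

(* H^0 of O(d) tensored with the direct image of O(- \sum_p m_p E_p): forms
   whose pullback lies, in the local ring of S_K at each of its points w, in
   the ideal of \sum_p m_p E_p.  Here u stands for the denominator, a unit of
   the local ring at w. *)
Definition sections (K : 'I_n -> ipoint) (m : 'I_n -> nat) (d : nat) :
    set {mpoly C[3]} :=
  [set F | F \is d.-homog /\
    forall w, on_blowup K w -> exists u g : poly2,
      u.@[fun=> 0] != 0 /\
      u * form_at w F = g * \prod_(i < n) total_exceptional (K i) w ^+ m i].

(* The clusters with given proximities form an irreducible variety: a tower
   of open subsets of P^2 (for a point of the plane), of P^1 (for a free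
   point), and of single points (for a satellite point, proximate to two
   others).  In the dense open subset where no point lies on the line at
   infinity of P^2, and where all directions at free points are finite, the
   clusters are given by the affine coordinates below, those of satellite
   points being constant. *)
Definition in_affine_part (K : 'I_n -> ipoint) : Prop :=
  forall i, (exists ab, (K i).1 = inl ab) /\
    ((#|[pred j | proximate (K i) (K j)]| <= 1)%N ->
     last (Some 0) (K i).2 <> None).

Definition point_coord (p : ipoint) : C * C :=
  match p with
  | (inl ab, [::]) => ab
  | (_, s) => if last None s is Some c then (c, 0) else (0, 0)
  end.

Definition coordinates (K : 'I_n -> ipoint) : 'I_(n + n) -> C :=
  fun k => match split k with
  | inl i => (point_coord (K i)).1
  | inr i => (point_coord (K i)).2
  end.

(* P holds on a nonempty Zariski open set of clusters with the proximities
   of K0. *)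
Definition for_general_clusters (K0 : 'I_n -> ipoint)
    (P : ('I_n -> ipoint) -> Prop) : Prop :=
  let X := [set K | [/\ is_clusters K, same_proximities K0 K
                      & in_affine_part K]] in
  exists Z : set ('I_(n + n) -> C), zariski_closed Z /\
    (exists2 K, X K & ~ Z (coordinates K)) /\
    (forall K, X K -> ~ Z (coordinates K) -> P K).

End Families.

(* The subtraction of natural numbers is truncated at 0. *)
Definition GLS_conjecture : Prop :=
  forall (n : nat) (K : 'I_n -> ipoint) (m : 'I_n -> nat) (d : nat),
    is_clusters K -> proximity_inequalities K m ->
    (sumn (take 3 (sort geq (codom m))) < d)%N ->
    for_general_clusters K (fun K' => has_dim (sections K' m d)
      ((d.+1 * d.+2)./2 - \sum_(i < n) (m i * (m i).+1)./2)%N).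

End Clusters.

Section Valuations.
Variable R : realType.
Notation C := R[i].
Notation poly2 := {mpoly C[2]}.
Notation varx := ('X_(0 : 'I_2) : poly2).
Notation vary := ('X_(1 : 'I_2) : poly2).

(* A power series in x is the sequence xi of its coefficients.  The
   coefficient a_ij of x^i (y - xi(x))^j in f is the one of x^i y^j in
   f(x, y + xi(x)), and the terms of xi of degree > i do not matter for it. *)
Definition qm_coef (xi : nat -> C) (f : poly2) (i j : nat) : C :=
  (f \mPo [tuple varx; vary + \sum_(k < i.+1) xi k *: varx ^+ k])
    @_[multinom [tuple i; j]].

(* For f <> 0 and 0 <= t the infimum is a minimum; the value at 0 is junk. *)
Definition qm_val (xi : nat -> C) (t : R) (f : poly2) : R :=
  inf [set s | exists i j : nat,
    qm_coef xi f i j != 0 /\ s = i%:R + t * j%:R].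

(* For a valuation this supremum is a maximum, since v takes finitely many
   values on the nonzero polynomials of degree at most d. *)
Definition mu (v : poly2 -> R) (d : nat) : R :=
  sup [set v f | f in [set f | f != 0 /\ (msize f <= d.+1)%N]].

Definition muhat (v : poly2 -> R) : R := limn (fun d => mu v d / d%:R).

(* For v centered at the origin, C[x,y] / I_m is also the quotient of the
   local ring at the origin by its ideal of elements of value at least m. *)
Definition val_ideal (v : poly2 -> R) (m : nat) : set poly2 :=
  [set f | f = 0 \/ m%:R <= v f].

Definition vol (v : poly2 -> R) : R :=
  limn (fun m => (colength (val_ideal v m))%:R / (m%:R ^+ 2 / 2) : R).

Definition minimal (v : poly2 -> R) : Prop :=
  cvgn (fun d => mu v d / d%:R) /\ muhat v = 1 / Num.sqrt (vol v).

(* P holds for all power series without constant term whose jets avoid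
   countably many proper Zariski closed sets. *)
Definition for_very_general_series (P : (nat -> C) -> Prop) : Prop :=
  exists (N : nat -> nat) (Z : forall k, set ('I_(N k) -> C)),
    (forall k, zariski_closed (Z k) /\ Z k <> setT) /\
    forall xi, xi 0%N = 0 ->
      (forall k, ~ Z k (fun i : 'I_(N k) => xi i.+1)) -> P xi.

End Valuations.

(* Main.v *)
From HB Require Import structures.
Require Import Defs.
From mathcomp Require Import all_boot all_order all_algebra.
From mathcomp Require Import complex mpoly.
From mathcomp Require Import boolp classical_sets reals.
From mathcomp Require Import topology normedtype sequences.
From mathcomp Require Import ring lra zify.

Set Implicit Arguments.
Unset Strict Implicit.
Unset Printing Implicit Defensive.

Import Order.TTheory GRing.Theory Num.Theory.
Import numFieldNormedType.Exports.

Local Open Scope ring_scope.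
Local Open Scope classical_set_scope.

(** Write v_t for v(xi,t).  The proof squeezes mu_d / d between two
    estimates, both of size sqrt t.

    Lower bound, for every xi.  By triangularity of y -> y + xi(x), the
    condition v_t(f) >= M on polynomials is given by one independent linear
    equation for each lattice point (i, j) of the quadrant with i + t j < M
    ([val_ideal_low_coefs], [low_coefs_surj]).  There are M^2 / (2t) + O(M)
    such points ([card_below_ge], [card_below_le]).  This is the colength of
    the valuation ideal, whence vol = 1/t; and as soon as it is less than the
    dimension (d+1)(d+2)/2 of the space of polynomials of degree at most d,
    some nonzero one has value at least M.  Hence mu_d is at least
    sqrt t * d - O(1).

    Upper bound, for very general xi.  For f <> 0, the value v_t(f) does not
    decrease with t, so it is enough to bound v_(b/a) for rational slopes b/a
    slightly above t, hence above 9.  The subtractive Euclidean algorithm on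
    (a, b) describes the chain of points that resolves v_(b/a): free points
    along the curve y = xi(x), then satellite points.  With multiplicities k
    times the numbers it subtracts, v_(b/a)(f) >= k b implies that f,
    homogenized, is a section of the corresponding sheaf
    ([homogenize_sections]); the multiplicities satisfy the proximity
    inequalities, are at most k a, and the sum of their squares is
    k^2 a b ([euclid_mults_sq]).  If 3 k a < d and (d+2)^2 <= k^2 a b, which is
    possible for large d because the slope exceeds 9, the conjecture says that
    a general cluster with these proximities has no nonzero section.

    To conclude that the chain of a very general xi has none, two points are
    needed.  A cluster with the proximities of a chain is itself the chain of
    some series at some point of the plane ([clusters_chain]), since a
    satellite point is determined by its proximities; so the conjecture
    provides one chain outside the exceptional closed set.  That chain starts
    at some point p of the plane instead of the origin; translating
    polynomials by p in the homogenization, and keeping p fixed while the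
    coefficients of xi vary, gives a proper closed condition on the jet of xi
    ([general_chain_sections], [admissible_vanishing]).  As (a, b, k, d) runs
    through a countable set, a very general xi avoids all of these conditions,
    and mu_d is at most k b for all admissible values, which gives
    mu_d <= d (sqrt t + e) for large d ([exists_admissible]). *)

(** * Weighted-order filtrations of polynomials in two variables *)

Local Notation varx := ('X_(0 : 'I_2)).
Local Notation vary := ('X_(1 : 'I_2)).

Lemma ord2P (i : 'I_2) : i = 0 \/ i = 1.
Proof. by case: i => [[|[|//]] ilt]; [left|right]; apply: val_inj. Qed.

Section Substitution.
Variable C : fieldType.
Implicit Types (f g p q : {mpoly C[2]}).

Lemma comp2X p q : varx \mPo [tuple p; q] = p.
Proof. by rewrite comp_mpolyXU. Qed.

Lemma comp2Y p q : vary \mPo [tuple p; q] = q.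
Proof. by rewrite comp_mpolyXU. Qed.

Lemma comp2E f (k : nat) (p q : {mpoly C[k]}) :
  f \mPo [tuple p; q] =
  \sum_(m <- msupp f) f@_m *: (p ^+ m 0 * q ^+ m 1).
Proof.
rewrite comp_mpolyE; apply: eq_bigr => m _.
rewrite big_ord_recl big_ord1 !(tnth_nth 0) /=.
by rewrite (_ : lift ord0 ord0 = 1) //; apply: val_inj.
Qed.

Lemma comp2A f p q (k : nat) (lr : 2.-tuple {mpoly C[k]}) :
  (f \mPo [tuple p; q]) \mPo lr = f \mPo [tuple p \mPo lr; q \mPo lr].
Proof.
rewrite !comp2E raddf_sum; apply: eq_bigr => m _ /=.
by rewrite comp_mpolyZ rmorphM !rmorphXn.
Qed.

Lemma comp2_id f : f \mPo [tuple varx; vary] = f.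
Proof.
rewrite -[RHS]comp_mpoly_id; congr (f \mPo _); apply: eq_from_tnth => i.
rewrite tnth_mktuple (tnth_nth 0) /=.
by have [->|->] := ord2P i.
Qed.

Lemma mnm2P (m m' : 'X_{1..2}) : m 0 = m' 0 -> m 1 = m' 1 -> m = m'.
Proof.
by move=> e0 e1; apply/mnmP => i; have [->|->] := ord2P i.
Qed.

End Substitution.

Section WeightFiltration.
Variables (W : realDomainType) (C : fieldType).
Implicit Types (f g p q : {mpoly C[2]}) (a b M N : W).

(** The real weights serve the valuations themselves, the integral ones the
    cluster computations; hence the general [W]. *)
Definition wfilt a b M f : Prop :=
  forall m, f@_m != 0 -> M <= a * (m 0)%:R + b * (m 1)%:R.

Lemma wfilt0 a b M : wfilt a b M 0.
Proof. by move=> m; rewrite mcoeff0 eqxx. Qed.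

Lemma wfiltD a b M f g : wfilt a b M f -> wfilt a b M g -> wfilt a b M (f + g).
Proof.
move=> hf hg m; rewrite mcoeffD; have [->|/hf//] := eqVneq f@_m 0.
by rewrite add0r => /hg.
Qed.

Lemma wfiltZ a b M c f : wfilt a b M f -> wfilt a b M (c *: f).
Proof. by move=> hf m; rewrite mcoeffZ mulf_eq0 negb_or => /andP[_ /hf]. Qed.

Lemma wfiltN a b M f : wfilt a b M f -> wfilt a b M (- f).
Proof. by move=> hf m; rewrite mcoeffN oppr_eq0 => /hf. Qed.

Lemma wfiltB a b M f g : wfilt a b M f -> wfilt a b M g -> wfilt a b M (f - g).
Proof. by move=> hf hg; apply: wfiltD => //; apply: wfiltN. Qed.

Lemma wfilt_sum a b M (I : Type) (r : seq I) (P : pred I) F :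
  (forall i, P i -> wfilt a b M (F i)) -> wfilt a b M (\sum_(i <- r | P i) F i).
Proof. by move=> hF; apply: big_ind => //; [exact: wfilt0|exact: wfiltD]. Qed.

Lemma wfilt_sum_in a b M (I : eqType) (r : seq I) F :
  (forall i, i \in r -> wfilt a b M (F i)) -> wfilt a b M (\sum_(i <- r) F i).
Proof. by move=> hF; rewrite big_seq; apply: wfilt_sum. Qed.

Lemma wfiltW a b M N f : N <= M -> wfilt a b M f -> wfilt a b N f.
Proof. by move=> NM hf m /hf; apply: le_trans. Qed.

Lemma wfiltM a b M N f g :
  wfilt a b M f -> wfilt a b N g -> wfilt a b (M + N) (f * g).
Proof.
move=> hf hg m hm.
have /msuppM_le/allpairsP[[m1 m2] /= [h1 h2 ->]] : m \in msupp (f * g).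
  by rewrite mcoeff_msupp.
rewrite mcoeff_msupp in h1; rewrite mcoeff_msupp in h2.
have := lerD (hf _ h1) (hg _ h2); rewrite !mnmDE !natrD.
by rewrite addrACA -!mulrDr.
Qed.

Lemma wfilt1 a b : wfilt a b 0 1.
Proof.
move=> m; rewrite mcoeff1; case: (eqVneq m) => [->|_]; last by rewrite eqxx.
by rewrite !mnm0E !mulr0 addr0.
Qed.

Lemma wfiltXn a b M f n : wfilt a b M f -> wfilt a b (M * n%:R) (f ^+ n).
Proof.
move=> hf; elim: n => [|n IH]; first by rewrite mulr0; exact: wfilt1.
by rewrite exprS -natr1 mulrDr mulr1 addrC; apply: wfiltM.
Qed.

Lemma wfiltX a b : wfilt a b a varx.
Proof.
move=> m; rewrite mcoeffX; case: (eqVneq _ m) => [<-|_]; last by rewrite eqxx.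
by rewrite !mnm1E /= mulr0 mulr1 addr0.
Qed.

Lemma wfiltY a b : wfilt a b b vary.
Proof.
move=> m; rewrite mcoeffX; case: (eqVneq _ m) => [<-|_]; last by rewrite eqxx.
by rewrite !mnm1E /= mulr0 mulr1 add0r.
Qed.

(** Substituting elements of weight at least those of x and y cannot lower the
    weight.  The two gradings may differ: this is how a weight condition is
    transported through a blowup. *)
Lemma wfilt_comp a b a' b' M f p q :
  wfilt a' b' a p -> wfilt a' b' b q -> wfilt a b M f ->
  wfilt a' b' M (f \mPo [tuple p; q]).
Proof.
move=> hp hq hf; rewrite comp2E; apply: wfilt_sum_in => m.
rewrite mcoeff_msupp => /hf hM; apply/wfiltZ/(wfiltW hM).
by apply: wfiltM; apply: wfiltXn.
Qed.

Lemma wfilt_divX a b M N (n : nat) g :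
  a * n%:R + N <= M -> wfilt a b M (varx ^+ n * g) -> wfilt a b N g.
Proof.
move=> hN h m hm; have := h (U_((0 : 'I_2)%R) *+ n + m)%MM.
rewrite mpolyXn -['X_[_] * g]mulrC mcoeffMX => /(_ hm).
rewrite !mnmDE !mulmnE !mnm1E /= mul1n mul0n add0n natrD.
by move=> hM; have := le_trans hN hM; rewrite mulrDr -addrA lerD2l.
Qed.

Lemma wfilt_divY a b M N (n : nat) g :
  b * n%:R + N <= M -> wfilt a b M (vary ^+ n * g) -> wfilt a b N g.
Proof.
move=> hN h m hm; have := h (U_((1 : 'I_2)%R) *+ n + m)%MM.
rewrite mpolyXn -['X_[_] * g]mulrC mcoeffMX => /(_ hm).
rewrite !mnmDE !mulmnE !mnm1E /= mul1n mul0n add0n natrD.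
move=> hM; have := le_trans hN hM.
by rewrite mulrDr addrCA lerD2l.
Qed.

Lemma wfilt_polyX a b (c : nat -> C) (s : seq nat) M :
  (forall k, k \in s -> M <= a * k%:R) ->
  wfilt a b M (\sum_(k <- s) c k *: varx ^+ k).
Proof.
move=> hs; apply: wfilt_sum_in => k /hs hk.
exact/wfiltZ/(wfiltW hk)/wfiltXn/wfiltX.
Qed.

End WeightFiltration.

(** Used with the x-adic weights (1, 0): truncating xi changes f(x, y + xi(x))
    only in high powers of x. *)
Lemma wfilt_comp_diff (W : realDomainType) (C : fieldType) (a b M : W)
    (f p q h : {mpoly C[2]}) :
  wfilt a b 0 p -> wfilt a b 0 q -> wfilt a b 0 h -> wfilt a b M (q - h) ->
  wfilt a b M ((f \mPo [tuple p; q]) - (f \mPo [tuple p; h])).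
Proof.
move=> hp hq hh hd; rewrite !comp2E -sumrB; apply: wfilt_sum => m _.
rewrite -scalerBr; apply: wfiltZ; rewrite -mulrBr subrXX.
rewrite -[M]add0r -[M]addr0; apply: wfiltM.
  by rewrite -[0](mul0r (m 0)%:R); apply: wfiltXn.
apply: wfiltM => //; apply: wfilt_sum => i _.
have w0 g n : wfilt a b 0 g -> wfilt a b 0 (g ^+ n).
  by move=> hg; rewrite -[0](mul0r n%:R); apply: wfiltXn.
by rewrite -[0](addr0 0); apply: wfiltM; apply: w0.
Qed.

(** A polynomial of order at least n at the origin is divisible by the n-th
    power of the exceptional equation after a blowup: in both charts the
    substitution has the form (e p, e q). *)
Lemma comp2_factor (C : fieldType) (n : nat) (f e p q : {mpoly C[2]}) :
  wfilt (1 : int) 1 n%:R f ->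
  exists g, f \mPo [tuple e * p; e * q] = e ^+ n * g.
Proof.
move=> hf.
exists (\sum_(m <- msupp f)
          f@_m *: (e ^+ (m 0 + m 1 - n) * (p ^+ m 0 * q ^+ m 1))).
rewrite comp2E mulr_sumr; apply: eq_big_seq => m.
rewrite mcoeff_msupp => /hf; rewrite !mul1r -natrD ler_nat => hm.
rewrite -scalerAr; congr (_ *: _); rewrite !exprMn.
by rewrite [RHS]mulrA -exprD subnKC // exprD -!mulrA (mulrCA (p ^+ _)).
Qed.

(** * Values of polynomials and the colength of valuation ideals *)

(** In these lemmas I is the kernel of a surjection onto a coordinate space, so
    a family represents V / I exactly when its image is a basis there. *)
Section Codimension.
Variables (C : fieldType) (V : lmodType C) (N : nat) (I : set V).
Variable phi : {linear V -> 'rV[C]_N}.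
Hypothesis phi_surj : forall c, exists f, phi f = c.
Hypothesis phiI : forall f, I f <-> phi f = 0.

Lemma linear_lincomb k (b : 'I_k -> V) (c : 'rV[C]_k) :
  phi (lincomb b c) = c *m \matrix_(i < k) phi (b i).
Proof.
rewrite /lincomb linear_sum mulmx_sum_row; apply: eq_bigr => i _.
by rewrite linearZ rowK.
Qed.

Lemma has_codimP k : has_codim I k <-> k = N.
Proof.
split=> [[b hb]|->]; last first.
  have [b hb] := choice (fun i : 'I_N => phi_surj (delta_mx 0 i)).
  exists b => f; exists (phi f); split=> [|c /phiI].
    apply/phiI; rewrite linearB linear_lincomb.
    rewrite (_ : (\matrix_i _) = 1%:M) ?mulmx1 ?subrr //.
    by apply/row_matrixP => i; rewrite rowK hb row1.
  rewrite linearB linear_lincomb (_ : (\matrix_i _) = 1%:M) ?mulmx1.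
    by move/eqP; rewrite subr_eq0 => /eqP.
  by apply/row_matrixP => i; rewrite rowK hb row1.
set B := \matrix_(i < k) phi (b i).
have full : row_full B.
  rewrite -sub1mx; apply/row_subP => i.
  have [f hf] := phi_surj (row i 1%:M); have [c [/phiI hc _]] := hb f.
  apply/submxP; exists c; move/eqP: hc.
  by rewrite linearB linear_lincomb subr_eq0 hf => /eqP.
have free : row_free B.
  rewrite -kermx_eq0; apply/eqP/row_matrixP => i; rewrite row0.
  have [c [_ hc]] := hb 0.
  rewrite -(hc (row i (kermx B))) ?(hc 0) //; apply/phiI.
    by rewrite linearB linear_lincomb linear0 mul0mx subrr.
  by rewrite linearB linear_lincomb linear0 -row_mul mulmx_ker row0 subrr.
by move: free full; rewrite /row_free /row_full => /eqP -> /eqP.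
Qed.

Lemma colengthE : colength I = N.
Proof.
rewrite /colength; case: xgetP => [k _ /has_codimP //|/(_ N)[]].
exact/has_codimP.
Qed.

End Codimension.

Section Straighten.
Variable C : fieldType.
Local Notation poly2 := {mpoly C[2]}.
Implicit Types (xi : nat -> C) (f : poly2).

(** The polynomial f in the coordinates x, y - xi(x), up to terms that depend
    on the coefficients of xi of degree above n. *)
Definition straighten xi n f : poly2 :=
  f \mPo [tuple varx; vary + \sum_(k < n.+1) xi k *: varx ^+ k].

Lemma straighten_is_linear xi n : linear (straighten xi n).
Proof. by move=> c f g; rewrite /straighten linearP. Qed.

HB.instance Definition _ xi n :=
  GRing.isLinear.Build C poly2 poly2 _ (straighten xi n)
    (straighten_is_linear xi n).

Definition mn2 (i j : nat) : 'X_{1..2} := [multinom [tuple i; j]].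

Lemma mn2_0 i j : mn2 i j 0 = i. Proof. by rewrite multinomE. Qed.
Lemma mn2_1 i j : mn2 i j 1 = j. Proof. by rewrite multinomE. Qed.
Lemma mn2E (m : 'X_{1..2}) : mn2 (m 0) (m 1) = m.
Proof. by apply: mnm2P; rewrite ?mn2_0 ?mn2_1. Qed.

Lemma wfilt_jet (W : realDomainType) (a b M : W) xi (n l : nat) :
  0 <= a -> (n <= l)%N -> M <= a * n%:R ->
  wfilt a b M (\sum_(n <= k < l) xi k *: varx ^+ k).
Proof.
move=> a0 nl hM; apply: wfilt_polyX => k; rewrite mem_index_iota => /andP[nk _].
by rewrite (le_trans hM)// ler_wpM2l// ler_nat.
Qed.

Lemma coef_straighten xi n f i j :
  (i <= n)%N ->
  (straighten xi n f)@_(mn2 i j) = (straighten xi i f)@_(mn2 i j).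
Proof.
move=> le_in; apply/eqP; rewrite -subr_eq0 -mcoeffB; apply/negPn/negP.
have w0 (l : nat) : wfilt (1 : int) 0 0 (\sum_(0 <= k < l) xi k *: varx ^+ k).
  by apply: wfilt_jet => //.
have diff : wfilt (1 : int) 0 i.+1%:R (straighten xi n f - straighten xi i f).
  apply: wfilt_comp_diff.
  - by apply: (@wfiltW _ _ _ _ 1); last exact: wfiltX.
  - apply: wfiltD; first exact: wfiltY.
    by rewrite -(big_mkord xpredT (fun k => xi k *: varx ^+ k)).
  - apply: wfiltD; first exact: wfiltY.
    by rewrite -(big_mkord xpredT (fun k => xi k *: varx ^+ k)).
  rewrite opprD addrACA subrr add0r.
  rewrite -!(big_mkord xpredT (fun k => xi k *: varx ^+ k)).
  rewrite (@big_cat_nat _ _ _ i.+1 0 n.+1) //= addrAC subrr add0r.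
  by apply: wfilt_jet => //; rewrite mul1r.
by move/diff; rewrite mn2_0 mn2_1 mul1r mul0r addr0 ler_nat ltnn.
Qed.

Lemma comp2_jet xi n (q : poly2) :
  (\sum_(k < n) xi k *: varx ^+ k) \mPo [tuple varx; q] =
  \sum_(k < n) xi k *: varx ^+ k.
Proof.
rewrite raddf_sum; apply: eq_bigr => k _ /=.
by rewrite comp_mpolyZ rmorphXn /= comp2X.
Qed.

Lemma straightenK xi n f :
  straighten xi n f \mPo
    [tuple varx; vary - \sum_(k < n.+1) xi k *: varx ^+ k] = f.
Proof.
by rewrite /straighten comp2A comp_mpolyD comp2_jet comp2X comp2Y subrK comp2_id.
Qed.

Lemma unstraightenK xi n f :
  straighten xi n (f \mPo
    [tuple varx; vary - \sum_(k < n.+1) xi k *: varx ^+ k]) = f.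
Proof.
by rewrite /straighten comp2A comp_mpolyB comp2_jet comp2X comp2Y addrK comp2_id.
Qed.

(** If all these coefficients vanished, f(x, y + xi(x)) truncated at degree n
    would lie in (x^(n+1)), and so would f, for every n. *)
Lemma straighten_coef_neq0 xi f :
  f != 0 -> exists i j, (straighten xi i f)@_(mn2 i j) != 0.
Proof.
move=> f0; apply: contrapT => hn.
have z i j : (straighten xi i f)@_(mn2 i j) = 0.
  by apply/eqP/negPn/negP => h; apply: hn; exists i, j.
have hN n : wfilt (1 : int) 0 n.+1%:R f.
  rewrite -(straightenK xi n f).
  apply: (@wfilt_comp _ C 1 0).
  - exact: wfiltX.
  - apply: wfiltB; first exact: wfiltY.
    rewrite -(big_mkord xpredT (fun k => xi k *: varx ^+ k)).
    by apply: wfilt_jet.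
  - move=> m; rewrite -(mn2E m) mn2_0 mn2_1 mul1r mul0r addr0 ler_nat.
    by apply: contraR; rewrite -leqNgt => h; rewrite coef_straighten // z.
move/eqP: f0; apply; apply/mpolyP => m; rewrite mcoeff0; apply/eqP/negPn/negP.
by move=> /(hN (m 0)); rewrite mul1r mul0r addr0 ler_nat ltnn.
Qed.

Section Below.
Variable R : realDomainType.
Implicit Types t : R.

(** The lattice points with i + t j < m; for 1 <= t they all have i, j < m, so
    the ambient finite type loses none ([below_mnm_onto]). *)
Definition below t m : {set 'I_m * 'I_m} :=
  [set p : 'I_m * 'I_m | p.1%:R + t * p.2%:R < m%:R].

Definition below_mnm t m (k : 'I_#|below t m|) : 'X_{1..2} :=
  let p : 'I_m * 'I_m := enum_val k in mn2 p.1 p.2.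

Lemma below_mnmP t m k :
  (@below_mnm t m k 0)%:R + t * (@below_mnm t m k 1)%:R < m%:R.
Proof. by have := enum_valP k; rewrite inE mn2_0 mn2_1. Qed.

Lemma below_mnm_inj t m : injective (@below_mnm t m).
Proof.
move=> k l; rewrite /below_mnm => e; apply: enum_val_inj; move: e.
case: (enum_val k) (enum_val l) => [a b] [a' b'] /= e.
congr pair; apply: val_inj => /=.
- by rewrite -[LHS](mn2_0 a b) e mn2_0.
- by rewrite -[LHS](mn2_1 a b) e mn2_1.
Qed.

Lemma below_mnm_onto t m (mm : 'X_{1..2}) : 1 <= t ->
  (mm 0)%:R + t * (mm 1)%:R < m%:R -> exists k, @below_mnm t m k = mm.
Proof.
move=> t1 hlt; have t0 : 0 <= t by apply: le_trans t1.
have i0 : (mm 0%R < m)%N.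
  rewrite -(ltr_nat R); apply: le_lt_trans hlt.
  by rewrite lerDl mulr_ge0.
have j0 : (mm 1%R < m)%N.
  rewrite -(ltr_nat R); apply: le_lt_trans hlt.
  apply: (@le_trans _ _ (t * (mm 1)%:R)); first exact: ler_peMl.
  by rewrite lerDr.
have hin : (Ordinal i0, Ordinal j0) \in below t m by rewrite inE.
exists (enum_rank_in hin (Ordinal i0, Ordinal j0)).
by rewrite /below_mnm enum_rankK_in //= mn2E.
Qed.

Definition low_coefs xi t m f : 'rV[C]_#|below t m| :=
  \row_k (straighten xi m f)@_(below_mnm k).

Lemma low_coefs_is_linear xi t m : linear (low_coefs xi t m).
Proof.
by move=> c f g; apply/rowP => k; rewrite !mxE straighten_is_linear mcoeffD mcoeffZ.
Qed.

HB.instance Definition _ xi t m :=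
  GRing.isLinear.Build C poly2 _ _ (low_coefs xi t m)
    (low_coefs_is_linear xi t m).

Lemma mcoeff_below t m (c : 'rV[C]_#|below t m|) k :
  (lincomb (fun l => 'X_[below_mnm l] : poly2) c)@_(below_mnm k) = c 0 k.
Proof.
rewrite raddf_sum (bigD1 k) //= mcoeffZ mcoeffX eqxx mulr1 big1 ?addr0 //.
move=> l lk; rewrite mcoeffZ mcoeffX.
by rewrite (inj_eq (@below_mnm_inj t m)) (negPf lk) mulr0.
Qed.

Lemma low_coefs_surj xi t m c : exists f, low_coefs xi t m f = c.
Proof.
exists (lincomb (fun l => 'X_[below_mnm l]) c \mPo
  [tuple varx; vary - \sum_(k < m.+1) xi k *: varx ^+ k]).
by apply/rowP => k; rewrite !mxE unstraightenK mcoeff_below.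
Qed.

Lemma low_coefsP xi t m f : 1 <= t ->
  low_coefs xi t m f = 0 <-> wfilt 1 t m%:R (straighten xi m f).
Proof.
move=> t1; split=> [h mm hm|h].
  rewrite mul1r leNgt; apply/negP => /(below_mnm_onto t1)[k hk].
  by move/rowP/(_ k): h hm; rewrite !mxE hk => ->; rewrite eqxx.
apply/rowP => k; rewrite !mxE; apply/eqP/negPn/negP => /h.
by rewrite mul1r leNgt below_mnmP.
Qed.

End Below.

End Straighten.

Section QuasiMonomial.
Variable R : realType.
Local Notation C := R[i].
Local Notation poly2 := {mpoly C[2]}.
Implicit Types (xi : nat -> C) (t : R) (f : poly2).

(** The infimum that defines the value is bounded below by 0 and taken over a
    nonempty set; jets of degree M suffice because a monomial x^i y^j with
    M <= i has weight at least M whatever its coefficient is. *)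
Lemma le_qm_val xi t f (M : nat) : 0 <= t -> f != 0 ->
  (M%:R <= qm_val xi t f <-> wfilt 1 t M%:R (straighten xi M f)).
Proof.
move=> t0 f0; split=> h.
  move=> m hm; rewrite mul1r leNgt; apply/negP => hlt.
  have ltM : (m 0%R <= M)%N.
    rewrite -(ler_nat R); apply/ltW/(le_lt_trans _ hlt).
    by rewrite lerDl mulr_ge0.
  move: hm; rewrite -(mn2E m) coef_straighten // => hm.
  suff : qm_val xi t f <= (m 0)%:R + t * (m 1)%:R.
    by move=> h'; move: (lt_le_trans hlt (le_trans h h')); rewrite ltxx.
  apply: ge_inf; last by exists (m 0), (m 1).
  by exists 0 => _ [i [j [_ ->]]]; rewrite addr_ge0 // mulr_ge0.
apply: lb_le_inf.
  by have [i [j hij]] := straighten_coef_neq0 xi f0; exists (i%:R + t * j%:R), i, j.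
move=> _ [i [j [hij ->]]]; have [iM|Mi] := leqP i M.
  have := h (mn2 i j); rewrite coef_straighten // mn2_0 mn2_1 mul1r; exact.
by rewrite (@le_trans _ _ i%:R) ?ler_nat ?(ltnW Mi) // lerDl mulr_ge0.
Qed.

Lemma val_ideal_low_coefs xi t m f : 1 <= t ->
  val_ideal (qm_val xi t) m f <-> low_coefs xi t m f = 0.
Proof.
move=> t1; have t0 : 0 <= t by apply: le_trans t1.
have [->|f0] := eqVneq f 0; first by split=> _; [rewrite linear0|left].
rewrite low_coefsP // -le_qm_val //.
by split=> [[/eqP|//]|]; [rewrite (negPf f0)|right].
Qed.

Lemma colength_val_ideal xi t m : 1 <= t ->
  colength (val_ideal (qm_val xi t) m) = #|below t m|.
Proof.
move=> t1; apply: (colengthE (phi := low_coefs xi t m)).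
- exact: low_coefs_surj.
- by move=> f; apply: val_ideal_low_coefs.
Qed.

(** More unknowns than equations: [below 1 d.+1] indexes the monomials of degree
    at most d. *)
Lemma exists_large_val xi t (M d : nat) : 1 <= t ->
  (#|below t M| < #|below (1 : R) d.+1|)%N ->
  exists f, [/\ f != 0, (msize f <= d.+1)%N & M%:R <= qm_val xi t f].
Proof.
move=> t1 lt_card; have t0 : 0 <= t by apply: le_trans t1.
pose mon (k : 'I_#|below (1 : R) d.+1|) : poly2 := 'X_[below_mnm k].
pose B := \matrix_k low_coefs xi t M (mon k).
have : kermx B != 0.
  rewrite kermx_eq0 /row_free; apply: contraL lt_card => /eqP <-.
  by rewrite -leqNgt rank_leq_col.
case/rowV0Pn => c /sub_kermxP cB c0; exists (lincomb mon c).
have f0 : lincomb mon c != 0.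
  apply: contraNneq c0 => z; apply/eqP/rowP => k.
  by rewrite -mcoeff_below -/mon z mcoeff0 mxE.
split=> //.
- rewrite msizeE; apply/bigmax_leqP_seq => m.
  move=> /msupp_sum_le /flattenP[s /mapP[k _ ->]] /msuppZ_le.
  rewrite msuppX inE => /eqP -> _.
  rewrite mdegE !big_ord_recl big_ord0 addn0.
  rewrite (_ : lift ord0 ord0 = 1); last exact: val_inj.
  by have := below_mnmP k; rewrite mul1r -natrD ltr_nat.
- by apply/le_qm_val => //; apply/low_coefsP; rewrite ?linear_lincomb.
Qed.

End QuasiMonomial.

(** * Lattice points under a line *)

Section Counting.
Variable R : realFieldType.
Implicit Types (t r x : R).

(** The number is the least natural number that is at least r. *)
Lemma count_below (m : nat) r : r <= m%:R ->
  exists n : nat, [/\ (\sum_(i < m) ((i%:R < r)%R : nat))%N = n, r <= n%:R &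
    (n = 0)%N \/ n%:R < r + 1].
Proof.
move=> rm; pose P n := r <= n%:R.
have exP : exists n, P n by exists m.
case: (ex_minnP exP) => n Pn minn; exists n.
have nm : (n <= m)%N by exact: minn.
split=> //; last first.
  case: n Pn minn {nm} => [|n] Pn minn; [by left|right].
  rewrite -natr1 ltrD2r ltNge; apply/negP => /minn.
  by rewrite ltnn.
rewrite -[RHS]card_ord -sum1_card (big_ord_widen_cond m xpredT (fun=> 1%N)) //.
rewrite [RHS]big_mkcond /=; apply: eq_bigr => i _.
have [lt_in|le_ni] := ltnP i n.
  rewrite (_ : i%:R < r) // ltNge; apply/negP => /minn.
  by rewrite leqNgt lt_in.
by rewrite (_ : (i%:R < r) = false) // ltNge (le_trans Pn) // ler_nat.
Qed.

Lemma card_belowE t m : #|below t m| =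
  (\sum_(j < m) \sum_(i < m) ((i%:R < m%:R - t * j%:R)%R : nat))%N.
Proof.
rewrite -sum1_card exchange_big pair_bigA big_mkcond /=.
by apply: eq_bigr => p _; rewrite inE ltrBrDr; case: ifP.
Qed.

(* As max(0, x)^2 is an antiderivative of 2 max(0, x), its differences with
   step t compare with the numbers of lattice points on horizontal lines, and
   their sum telescopes. *)
Let sq x : R := if 0 <= x then x ^+ 2 else 0.

Lemma sq_ge0 x : 0 <= sq x.
Proof. by rewrite /sq; case: ifP => // _; rewrite sqr_ge0. Qed.

Lemma sq_diff_le t x : 0 <= t -> 0 <= x -> sq x - sq (x - t) <= 2 * t * x.
Proof.
move=> t0 x0; rewrite /sq x0; case: ifP => h; first by nra.
by move/negbT: h; rewrite -ltNge => h; nra.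
Qed.

Lemma sq_diff_ge t x : 0 <= t -> t <= x -> 2 * t * (x - t / 2) <= sq x - sq (x - t).
Proof.
move=> t0 x0; rewrite /sq subr_ge0 x0 (le_trans t0 x0).
by rewrite le_eqVlt; apply/orP; left; apply/eqP; field.
Qed.

Lemma sq_le x y : x <= y -> sq x <= sq y.
Proof.
move=> xy; rewrite /sq; case: ifP => h; last by case: ifP => //; rewrite sqr_ge0.
by rewrite (le_trans h xy) ler_pXn2r // ?nnegrE // (le_trans h xy).
Qed.

Lemma telescope_ord (G : nat -> R) m :
  \sum_(j < m) (G j - G j.+1) = G 0%N - G m.
Proof.
rewrite -(big_mkord xpredT (fun j => G j - G j.+1)).
rewrite -[RHS]opprB -telescope_sumr // -sumrN.
by apply: eq_bigr => i _; rewrite opprB.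
Qed.

Lemma card_below_ge t m : 1 <= t ->
  m%:R ^+ 2 / (2 * t) <= #|below t m|%:R.
Proof.
move=> t1; have t0 : 0 < t by apply: lt_le_trans t1.
rewrite ler_pdivrMr ?mulr_gt0 // card_belowE natr_sum mulr_suml.
have -> : m%:R ^+ 2 = \sum_(j < m) (sq (m%:R - t * j%:R) - sq (m%:R - t * j.+1%:R)).
  rewrite (telescope_ord (fun j => sq (m%:R - t * j%:R))) mulr0 subr0.
  rewrite {1}/sq ler0n [X in _ - X](_ : _ = 0) ?subr0 // /sq.
  case: ifP => // h; apply/eqP; rewrite sqrf_eq0 eq_le h andbT subr_le0.
  exact: ler_peMl.
apply: ler_sum => j _; set r := m%:R - t * j%:R.
have -> : m%:R - t * j.+1%:R = r - t by rewrite /r -natr1 mulrDr mulr1 opprD addrA.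
have rm : r <= m%:R by rewrite /r lerBlDr lerDl mulr_ge0 // ltW.
have [n [-> rn _]] := count_below rm.
have [r0|r0] := leP 0 r.
  apply: (le_trans (sq_diff_le (ltW t0) r0)).
  by rewrite mulrC ler_wpM2r ?mulr_ge0 // ltW.
have -> : sq r = 0 by rewrite /sq leNgt r0.
rewrite sub0r (@le_trans _ _ 0) ?oppr_le0 ?sq_ge0 //.
by rewrite !mulr_ge0 // ltW.
Qed.

Lemma card_below_le t m : 1 <= t ->
  #|below t m|%:R <= (m%:R + t + 1) ^+ 2 / (2 * t).
Proof.
move=> t1; have t0 : 0 < t by apply: lt_le_trans t1.
rewrite ler_pdivlMr ?mulr_gt0 // card_belowE natr_sum mulr_suml.
(* The shift by t + 1 makes each difference exceed its line count, which is at
   most r + 1. *)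
pose G j := sq (m%:R - t * j%:R + (t + 1)).
apply: (@le_trans _ _ (\sum_(j < m) (G j - G j.+1))); last first.
  rewrite telescope_ord {1}/G mulr0 subr0 /sq addrA.
  by rewrite !addr_ge0 ?(ltW t0) // gerBl sq_ge0.
apply: ler_sum => j _; rewrite /G; set r := m%:R - t * j%:R.
have -> : m%:R - t * j.+1%:R + (t + 1) = r + (t + 1) - t.
  by rewrite /r -natr1; ring.
have rm : r <= m%:R by rewrite /r lerBlDr lerDl mulr_ge0 // ltW.
have [n [-> rn [->|nr]]] := count_below rm.
  by rewrite mul0r subr_ge0 sq_le // gerBl ltW.
have [r0|r0] := leP 0 r.
  apply: le_trans (sq_diff_ge (ltW t0) _); last by rewrite addrCA lerDl addr_ge0.
  rewrite mulrC ler_wpM2l ?mulr_ge0 ?(ltW t0) //.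
  by apply: (le_trans (ltW nr)); lra.
have -> : n = 0%N.
  apply/eqP; rewrite -leqn0 -ltnS -(ltr_nat R); lra.
by rewrite mul0r subr_ge0 sq_le // gerBl ltW.
Qed.

End Counting.

(** * Chains of infinitely near points *)

Lemma prefix_take (T : eqType) i (s : seq T) : prefix (take i s) s.
Proof. by rewrite -{2}(cat_take_drop i s) prefix_prefix. Qed.

Section ChainClusters.
Variable C : fieldType.
Implicit Types (r : pplane C) (D : seq (direction C)) (s : seq bool).
Implicit Types (c : nat -> C).

Lemma precedes_take r D i j : (i <= size D)%N -> (j <= size D)%N ->
  precedes (r, take i D) (r, take j D) = (i < j)%N.
Proof.
move=> iD jD; rewrite /precedes eqxx /= !size_takel //.
rewrite andb_idl // => ij.
by rewrite -(take_takel _ (ltnW ij)) prefix_take.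
Qed.

(** For two points of one chain, proximity is a condition on the directions in
    between: all of them point along the exceptional divisor of the earlier
    point. *)
Lemma proximate_take r D i j : (i <= size D)%N -> (j <= size D)%N ->
  proximate (r, take j D) (r, take i D) = (i < j)%N &&
  all (fun l => nth None D l == exceptional_dir (nth None D i))
      (iota i.+1 (j - i.+1)).
Proof.
move=> iD jD; rewrite /proximate precedes_take //=; case: ltnP => //= ij.
rewrite size_takel // (drop_nth None) ?size_takel // nth_take //=.
rewrite -[X in drop _ (take X _)](subnK ij) -take_drop -(map_nth_iota None).
  by rewrite all_map.
by rewrite leq_sub2r.
Qed.

(** The directions of a chain of points, where [true] stands for a finite
    direction.  As long as only finite directions occur, they follow the curve
    y = sum of the c_l x^l; after the first infinite one, every point is a
    satellite and a finite direction can only be that of an older exceptional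
    divisor, which is 0. *)
Fixpoint dirs s c : seq (direction C) :=
  match s with
  | [::] => [::]
  | true :: s' => Some (c 1%N) :: dirs s' (fun l => c l.+1)
  | false :: s' => None :: dirs s' (fun=> 0)
  end.

Lemma size_dirs s c : size (dirs s c) = size s.
Proof. by elim: s c => [|[] s IH] c //=; rewrite IH. Qed.

Lemma nth_dirs s c l : nth None (dirs s c) l =
  if nth false s l then Some (if all id (take l s) then c l.+1 else 0)
  else None.
Proof.
elim: s c l => [|b s IH] c [|l] //=; first by case: b.
by case: b => /=; rewrite IH //=; case: ifP => //; case: ifP.
Qed.

Definition chain s r c : 'I_(size s).+1 -> ipoint C :=
  fun i => (r, take i (dirs s c)).
Arguments chain : clear implicits.

(** Proximity in a chain only depends on the bits: after a finite direction,
    the proper transform of the new divisor is met in the infinite direction,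
    and after an infinite one it is met in the direction 0, which is then the
    only finite one in the chain. *)
Definition bit_prox s (j i : nat) : bool :=
  (i < j)%N && all (fun l => nth false s l == ~~ nth false s i)
                   (iota i.+1 (j - i.+1)).

Lemma bit_proxP s j i : reflect
  ((i < j)%N /\ forall l, (i < l < j)%N -> nth false s l = ~~ nth false s i)
  (bit_prox s j i).
Proof.
apply: (iffP andP) => -[ij h]; split=> //.
  move=> l /andP[il lj]; apply/eqP/(allP h); rewrite mem_iota il /=.
  by rewrite subnKC.
by apply/allP => l; rewrite mem_iota subnKC // => hl; apply/eqP/h.
Qed.

Lemma proximate_chain s r c i j :
  proximate (chain s r c i) (chain s r c j) = bit_prox s i j.
Proof.
have le (k : 'I_(size s).+1) : (k <= size (dirs s c))%N.
  by rewrite size_dirs -ltnS.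
rewrite proximate_take // /bit_prox; case: ltnP => //= ji.
apply: eq_in_all => l; rewrite mem_iota subnKC // => /andP[jl li].
rewrite !nth_dirs; case hj: (nth false s j) => /=; first by case: ifP.
rewrite (_ : all id (take l s) = false); first by case: ifP; rewrite ?eqxx.
apply/negbTE/(all_nthP false) => /(_ j).
have js : (j < size s)%N by rewrite (leq_trans ji) // -ltnS.
have jt : (j < size (take l s))%N by rewrite size_take; case: ifP.
by move/(_ jt); rewrite nth_take // hj.
Qed.

Lemma same_proximities_chain s r c r' c' :
  same_proximities (chain s r c) (chain s r' c').
Proof. by move=> i j; rewrite !proximate_chain. Qed.

Lemma chain_is_clusters s r c : is_clusters (chain s r c).
Proof.
have le (k : 'I_(size s).+1) : (k <= size (dirs s c))%N.
  by rewrite size_dirs -ltnS.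
split=> [i j [/(congr1 size)]|j [r' q]].
  by rewrite !size_takel // => /val_inj.
rewrite /precedes /= => /and3P[/eqP -> hp]; rewrite size_takel // => hlt.
have qs : (size q < (size s).+1)%N by rewrite (ltn_trans hlt).
exists (Ordinal qs); rewrite /chain /=; congr pair.
have := hp; rewrite prefixE => /eqP {2}<-.
by rewrite take_takel // ltnW.
Qed.

(** The last bit before l that differs from bit l belongs to a point to which the point
    after direction l is proximate, which makes the latter a satellite. *)
Lemma exists_bit_prox s l : (exists j, (j < l)%N /\ nth false s j != nth false s l) ->
  exists j, [/\ (j < l)%N, nth false s j = ~~ nth false s l
             & bit_prox s l.+1 j].
Proof.
move=> [j0 [j0l hj0]].
pose P j := (j < l)%N && (nth false s j != nth false s l).
have exP : exists j, P j by exists j0; rewrite /P j0l.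
have ubP j : P j -> (j <= l)%N by case/andP => /ltnW.
case: (ex_maxnP exP ubP) => j /andP[jl hj] maxj.
have e : nth false s j = ~~ nth false s l.
  by case: (nth false s j) hj; case: (nth false s l).
exists j; split=> //; apply/bit_proxP; split; first by rewrite ltnS ltnW.
move=> k /andP[jk kl]; rewrite e negbK.
move: kl; rewrite ltnS leq_eqVlt => /orP[/eqP -> //|kl].
apply/eqP; apply: contraLR jk => hk; rewrite -leqNgt; apply: maxj.
by rewrite /P kl.
Qed.

Lemma last_take D i (d : direction C) :
  (i < size D)%N -> last d (take i.+1 D) = nth None D i.
Proof. by move=> iD; rewrite (take_nth None iD) last_rcons. Qed.

(** A point in the infinite direction is proximate to two points, because the
    first direction is finite: the affine part only asks free points for a
    finite direction. *)
Lemma chain_in_affine_part s ab c : nth true s 0 -> in_affine_part (chain s (inl ab) c).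
Proof.
move=> s0 i; split; first by exists ab.
rewrite [(chain _ _ _ i).2]/=; case: i => -[|i] ilt; first by rewrite take0.
have is_ : (i < size s)%N by [].
rewrite last_take ?size_dirs // nth_dirs; case hi: (nth false s i) => //.
rewrite leqNgt => /negP[].
have [|j [ji ej pj]] := @exists_bit_prox s i.
  exists 0%N; rewrite hi (set_nth_default true) ?s0 ?(leq_trans _ is_) //.
  by case: (i) hi is_ => // h h'; move: s0; rewrite (set_nth_default false) ?h.
have jlt : (j < (size s).+1)%N by rewrite (ltn_trans ji) // ltnW.
have ilt' : (i < (size s).+1)%N by rewrite ltnW.
apply/card_gt1P; exists (Ordinal jlt), (Ordinal ilt'); split.
- by rewrite inE proximate_chain.
- rewrite inE proximate_chain; apply/bit_proxP; split=> // l /=.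
  by rewrite ltnS => /andP[/leq_trans h /h]; rewrite ltnn.
- by apply/eqP => -[] e; rewrite e ltnn in ji.
Qed.

(** Successive points are proximate, so all precede the last one; conversely
    all predecessors of the last point belong to the cluster.  Counting, these
    predecessors are exactly the other points, in order. *)
Lemma clusters_same_chain s (r : pplane C) c K :
  is_clusters K -> same_proximities (chain s r c) K ->
  exists r' D, size D = size s /\ forall i, K i = (r', take i D).
Proof.
set n := size s => -[Kinj Kcl] Kprox.
pose f i := size (K i).2.
have step (i j : 'I_n.+1) : j = i.+1 :> nat -> precedes (K i) (K j).
  move=> ji; suff /andP[] : proximate (K j) (K i) by [].
  rewrite -Kprox proximate_chain; apply/bit_proxP; rewrite ji; split=> // l.
  by rewrite ltnS => /andP[/leq_trans h /h]; rewrite ltnn.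
have trans p q o : precedes p q -> precedes q o -> @precedes C p o.
  move=> /and3P[/eqP e1 p1 l1] /and3P[/eqP e2 p2 l2].
  by rewrite /precedes e1 e2 eqxx (prefix_trans p1 p2) (ltn_trans l1 l2).
have prec (i j : 'I_n.+1) : (i < j)%N -> precedes (K i) (K j).
  case: j => j jlt /=; elim: j jlt => [//|j IH] jlt.
  have jlt' : (j < n.+1)%N by rewrite ltnW.
  rewrite ltnS leq_eqVlt => /orP[/eqP e|ij]; first by apply: step; rewrite /= e.
  exact: trans (IH jlt' ij) (step (Ordinal jlt') _ _).
set r' := (K ord_max).1; set D := (K ord_max).2.
have fle (i : 'I_n.+1) : (i <= f i)%N.
  case: i => i ilt /=; elim: i ilt => [//|i IH] ilt.
  have ilt' : (i < n.+1)%N by rewrite ltnW.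
  apply: leq_ltn_trans (IH ilt') _.
  by have /and3P[] := step (Ordinal ilt') (Ordinal ilt) erefl.
have Kpre (i : 'I_n.+1) : K i = (r', take (f i) D).
  have [im|] := eqVneq i ord_max; first by rewrite im /f take_size -surjective_pairing.
  move=> im; have : (i < (ord_max : 'I_n.+1))%N.
    rewrite ltn_neqAle -ltnS ltn_ord andbT.
    by apply: contraNneq im => e; apply/eqP/val_inj.
  move/prec => /and3P[/eqP e1 p1 _]; rewrite /r' -e1.
  by move: p1; rewrite prefixE => /eqP ->; rewrite -surjective_pairing.
have surj (v : 'I_(size D).+1) : exists i, f i = v.
  have vD : (v <= size D)%N by rewrite -ltnS.
  move: (vD); rewrite leq_eqVlt => /orP[/eqP e|vlt]; first by exists ord_max; rewrite e.
  have [] := Kcl ord_max (r', take v D); last first.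
    by move=> i e; exists i; rewrite /f e size_takel.
  by rewrite /precedes eqxx /= prefix_take size_takel.
have [h hf] := choice surj.
have hinj : injective h by move=> u v e; apply: val_inj; rewrite /= -!hf e.
have Dn : size D = n.
  apply/eqP; rewrite eqn_leq (fle ord_max) andbT -ltnS.
  by have := leq_card h hinj; rewrite !card_ord.
exists r', D; split=> // i; rewrite Kpre; congr (_, take _ _).
apply/eqP; rewrite eqn_leq fle andbT.
have finj (a b : 'I_n.+1) : (a < b)%N -> (f a < f b)%N.
  by move/prec => /and3P[].
have fub (j : nat) (jn : (j < n.+1)%N) : (f (Ordinal jn) + (n - j) <= n)%N.
  have [e ejn] : exists e, e = (n - j)%N by exists (n - j)%N.
  elim: e j jn ejn => [|e IH] j jn ejn.
    have jn' : j = n by apply/eqP; rewrite eqn_leq -ltnS jn -subn_eq0 -ejn.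
    rewrite -ejn addn0 (_ : f (Ordinal jn) = size D) ?Dn //.
    by rewrite /f /D (_ : Ordinal jn = ord_max) //; apply: val_inj.
  have j1 : (j.+1 < n.+1)%N by lia.
  have e1 : e = (n - j.+1)%N by lia.
  have := IH j.+1 j1 e1; rewrite -e1 -ejn.
  by have := finj (Ordinal jn) (Ordinal j1) (ltnSn _); lia.
have := fub i (ltn_ord i); rewrite (_ : Ordinal _ = i); last exact: val_inj.
by have := ltn_ord i; lia.
Qed.

End ChainClusters.

Arguments chain {C} s r c i.

(** * Clusters with the proximities of a chain *)

Section Reconstruction.
Variable C : fieldType.

(** Inductively along the chain: the direction of a satellite point is the one
    of the older exceptional divisor it lies on, which is already known; a free
    point has a finite direction by the choice of affine part, and this
    direction supplies the next coefficient of the series. *)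
Lemma clusters_chain s (r0 : pplane C) c0 K : nth true s 0 ->
  is_clusters K -> same_proximities (chain s r0 c0) K -> in_affine_part K ->
  exists ab c, K = chain s (inl ab) c.
Proof.
move=> s0 Kcl Kprox Kaff.
have [r [D [Ds KE]]] := clusters_same_chain Kcl Kprox.
have [[ab rE] _] := Kaff ord0; rewrite KE /= in rE.
have proxE (i j : 'I_(size s).+1) : (j < i)%N ->
    bit_prox s i j = all (fun l => nth None D l == exceptional_dir (nth None D j))
      (iota j.+1 (i - j.+1)).
  have le (k : 'I_(size s).+1) : (k <= size D)%N by rewrite Ds -ltnS.
  move=> ji; have := Kprox i j.
  by rewrite proximate_chain !KE proximate_take // => ->; rewrite ji.
pose c l : C := if nth None D l.-1 is Some x then x else 0.
exists ab, c; apply/funext => i; rewrite KE /chain rE.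
suff -> : D = dirs s c by [].
apply: (@eq_from_nth _ None); first by rewrite size_dirs.
move=> l; rewrite Ds; elim/ltn_ind: l => l IH ls.
have ll : (l.+1 < (size s).+1)%N by [].
have [ch|noch] := pselect (exists j, (j < l)%N /\ nth false s j != nth false s l).
  have [j [jl sj pj]] := exists_bit_prox ch.
  have jlt : (j < (size s).+1)%N by rewrite ltnS ltnW // (ltn_trans jl).
  have : bit_prox s (Ordinal ll) (Ordinal jlt) by [].
  rewrite proxE /=; last by rewrite ltnS ltnW.
  move=> /allP/(_ l); rewrite mem_iota subnKC ?ltnS ?(ltnW jl) // jl leqnn.
  move=> /(_ isT)/eqP ->; rewrite (IH j jl (ltn_trans jl ls)) !nth_dirs sj.
  case sl: (nth false s l) => //=; rewrite sl in sj.
  case: ifP => // /(all_nthP false)/(_ j); rewrite size_takel ?(ltnW ls) //.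
  by rewrite nth_take // sj => /(_ jl).
have same j : (j < l)%N -> nth false s j = nth false s l.
  by move=> jl; apply/eqP/negPn/negP => h; apply: noch; exists j.
have sl : nth false s l.
  move: s0; rewrite (set_nth_default false) ?(leq_ltn_trans _ ls) //.
  by case: (posnP l) => [->|/same ->].
have alls : all id (take l s).
  apply/(all_nthP false) => j; rewrite size_takel ?(ltnW ls) // => jl.
  by rewrite nth_take // same.
suff free : nth None D l <> None.
  by rewrite nth_dirs sl alls /c /=; case: (nth None D l) free.
have [_] := Kaff (Ordinal ll).
have -> : (K (Ordinal ll)).2 = take l.+1 D by rewrite KE.
rewrite last_take ?Ds //; apply.
have llt : (l < (size s).+1)%N by rewrite ltnW.
apply: (@leq_trans #|pred1 (Ordinal llt)|); last by rewrite card1.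
apply: subset_leq_card; apply/fintype.subsetP => j.
rewrite !inE -Kprox proximate_chain => /bit_proxP[/= jl h].
apply/eqP/val_inj/eqP; rewrite /= eqn_leq -ltnS jl /= leqNgt; apply/negP => lj.
have := h l; rewrite lj ltnS leqnn => /(_ isT).
by rewrite (same j) // sl.
Qed.

Lemma zariski_closed_preimage (N M : nat) (p : N.-tuple {mpoly C[M]})
    (Z : set ('I_N -> C)) : zariski_closed Z ->
  zariski_closed [set x | Z (fun k => (tnth p k).@[x])].
Proof.
move=> [S ->]; exists [set h | exists2 g, S g & h = g \mPo p].
apply/seteqP; split=> x /= h.
  by move=> _ [g Sg ->]; rewrite comp_mpoly_meval; apply: h.
by move=> g Sg; rewrite -comp_mpoly_meval; apply: h; exists g.
Qed.

(** The coordinates of the chain with base point ab, as polynomials in the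
    coefficients of the series; the base point is kept constant. *)
Definition chain_coord s (ab : C * C) :
    ((size s).+1 + (size s).+1).-tuple {mpoly C[size s]} :=
  [tuple match split k with
   | inl i => oapp (fun l : 'I_(size s) =>
        if nth false s l && all id (take l s) then 'X_l else 0) ab.1%:MP
        (unlift ord0 i)
   | inr i => oapp (fun=> 0) ab.2%:MP (unlift ord0 i)
   end | k < (size s).+1 + (size s).+1].

Lemma coordinates_chain s ab (c : nat -> C) k :
  coordinates (chain s (inl ab) c) k =
  (tnth (chain_coord s ab) k).@[fun i : 'I_(size s) => c i.+1].
Proof.
rewrite tnth_mktuple /coordinates; case: split => i.
  case: unliftP => [l ->|->] /=; last first.
    by rewrite /chain /= take0 mevalC; case: (ab).
  have -> : (point_coord (chain s (inl ab) c (lift ord0 l))).1 =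
     if nth None (dirs s c) l is Some x then x else 0.
    rewrite -(last_take None) ?size_dirs // /chain /= /bump /=.
    rewrite /point_coord /=; case: (dirs s c) (size_dirs s c) => [|d D] e.
      by have := ltn_ord l; rewrite -{2}e.
    by move=> /=; case: last.
  rewrite nth_dirs; case: ifP => //= _; last by rewrite meval0.
  by case: ifP; rewrite ?mevalXU ?meval0.
case: unliftP => [l ->|->] /=; last first.
  by rewrite /chain /= take0 mevalC; case: (ab).
rewrite meval0 /chain /= /bump /= /point_coord.
case: (dirs s c) (size_dirs s c) => [|d D] e.
      by have := ltn_ord l; rewrite -{2}e.
by move=> /=; case: last.
Qed.

End Reconstruction.

(** The conjecture yields a cluster outside the exceptional set Z; it is a chain
    based at some ab.  Restricting Z to the chains based at this ab gives a
    closed set of jets, and it is proper since this one chain avoids it. *)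
Lemma general_chain_sections (C : fieldType) s (m : 'I_(size s).+1 -> nat) d :
  GLS_conjecture C -> nth true s 0 ->
  proximity_inequalities (chain s (inl (0, 0) : pplane C) (fun=> 0)) m ->
  (sumn (take 3 (sort geq (codom m))) < d)%N ->
  ((d.+1 * d.+2)./2 <= \sum_i (m i * (m i).+1)./2)%N ->
  exists ab (Z : set ('I_(size s) -> C)),
    [/\ zariski_closed Z, Z <> setT &
     forall xi : nat -> C, ~ Z (fun i => xi i.+1) ->
     forall F, sections (chain s (inl ab) xi) m d F -> F = 0].
Proof.
move=> gls s0 prox md hdim.
have [Z [Zcl [[K [Kcl Kprox Kaff] KZ] gen]]] :=
  gls _ _ m d (chain_is_clusters _ _ _) prox md.
have [ab [c KE]] := clusters_chain s0 Kcl Kprox Kaff.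
have coordE (xi : nat -> C) : coordinates (chain s (inl ab) xi) =
    fun k => (tnth (chain_coord s ab) k).@[fun i => xi i.+1].
  by apply/funext => k; apply: coordinates_chain.
exists ab, [set x | Z (fun k => (tnth (chain_coord s ab) k).@[x])]; split.
- exact: zariski_closed_preimage.
- move=> /seteqP[_ /(_ (fun i => c i.+1) I)] /=.
  by rewrite -coordE -KE.
- move=> xi /=; rewrite -coordE => hxi F hF.
  have Xxi : [/\ is_clusters (chain s (inl ab) xi),
      same_proximities (chain s (inl (0, 0)) (fun=> 0)) (chain s (inl ab) xi)
      & in_affine_part (chain s (inl ab) xi)].
    split; [exact: chain_is_clusters|exact: same_proximities_chain|].
    exact: chain_in_affine_part.
  have [b [_ hb]] := gen _ Xxi hxi.
  move: b hb; rewrite (eqP hdim) => b hb.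
  by move: hF; rewrite hb => -[v _ <-]; rewrite /lincomb big_ord0.
Qed.

(** * The cluster of a rational slope *)

(** The subtractive Euclidean algorithm, n being fuel.  In a chart where x and y
    have weights a and b, blowing up and following the valuation subtracts the
    smaller weight from the larger one, in a finite direction if a < b and in
    the infinite one if b < a; the algorithm stops at equal weights, where the
    valuation is proportional to the multiplicity at the point.  The
    multiplicities are the numbers subtracted, and the common value at the
    end. *)
Fixpoint euclid_bits (n a b : nat) : seq bool :=
  if n is n'.+1 then
    if (a < b)%N then true :: euclid_bits n' a (b - a)
    else if (b < a)%N then false :: euclid_bits n' (a - b) b
    else [::]
  else [::].

Fixpoint euclid_mults (n a b : nat) : seq nat :=
  minn a b ::
  if n is n'.+1 then
    if (a < b)%N then euclid_mults n' a (b - a)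
    else if (b < a)%N then euclid_mults n' (a - b) b
    else [::]
  else [::].

Lemma size_euclid_mults n a b :
  size (euclid_mults n a b) = (size (euclid_bits n a b)).+1.
Proof.
elim: n a b => [|n IH] a b //=.
by case: ifP => //= _; [rewrite IH|case: ifP => //= _; rewrite IH].
Qed.

Lemma euclid_mults_le n a b : all (fun m => m <= a)%N (euclid_mults n a b).
Proof.
elim: n a b => [|n IH] a b /=; first by rewrite geq_minl.
rewrite geq_minl /=; case: ifP => // _; case: ifP => // _.
by apply: sub_all (IH (a - b)%N b) => m /leq_trans; apply; rewrite leq_subr.
Qed.

(** From a b = a^2 + a (b - a). *)
Lemma euclid_mults_sq n a b : (0 < a)%N -> (0 < b)%N -> (a + b <= n)%N ->
  (\sum_(m <- euclid_mults n a b) m ^ 2 = a * b)%N.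
Proof.
elim: n a b => [|n IH] a b a0 b0 abn; first lia.
rewrite /= big_cons; case: ltnP => [ab|ba].
  by rewrite IH; nia.
case: ltnP => [ba'|ab]; first by rewrite IH; nia.
by rewrite big_nil; nia.
Qed.

(** The multiplicities of the points proximate to a given one: in a chain these
    are the next point and those that follow as long as the bit is [e]. *)
Fixpoint run_sum (e : bool) (s : seq bool) (M : seq nat) {struct M} : nat :=
  if M is m :: M' then
    m + (if s is e' :: s' then if e' == e then run_sum e s' M' else 0 else 0)
  else 0.

(** Subtractions of b from a that occur in a row, with the multiplicity that
    comes after them, total at most a; this is the proximity inequality. *)
Lemma run_sum_euclid e n a b :
  (run_sum e (euclid_bits n a b) (euclid_mults n a b) <= if e then b else a)%N.
Proof.
elim: n a b => [|n IH] a b /=; first by case: e; rewrite addn0 ?geq_minl ?geq_minr.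
case: ltnP => [ab|ba]; first by have := IH a (b - a)%N; case: e {IH} => /=; lia.
case: ltnP => [ba'|ab]; first by have := IH (a - b)%N b; case: e {IH} => /=; lia.
by case: e {IH} => /=; rewrite addn0 ?geq_minl ?geq_minr.
Qed.

Lemma run_sumE e s M : size M = (size s).+1 ->
  run_sum e s M =
  (\sum_(0 <= j < size M | all (pred1 e) (take j s)) nth 0 M j)%N.
Proof.
elim: M s => [//|m M IH] s /= [sM].
rewrite big_mkcond big_nat_recl //= take0 /=. congr (_ + _)%N.
case: s sM => [|e' s] sM.
  by rewrite sM big_nil.
case: eqP => [->|ne].
  rewrite IH // [LHS]big_mkcond; apply: eq_bigr => j _ /=.
  by rewrite eqxx.
rewrite big1 // => j _ /=.
by move/eqP/negbTE: ne => ->.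
Qed.

Lemma bit_prox_cons0 b s j : (j <= size s)%N ->
  bit_prox (b :: s) j.+1 0 = all (pred1 (~~ b)) (take j s).
Proof.
move=> js; rewrite /bit_prox /= subSS subn0.
rewrite -(map_nth_iota0 false js) all_map (iotaDl 1 0) all_map.
by apply: eq_all => l.
Qed.

Lemma bit_prox_consS b s j i : bit_prox (b :: s) j.+1 i.+1 = bit_prox s j i.
Proof.
rewrite /bit_prox ltnS subSS; congr (_ && _).
by rewrite (iotaDl 1 i.+1) all_map; apply: eq_all => l.
Qed.

Lemma euclid_proximity n a b i :
  (\sum_(0 <= j < size (euclid_mults n a b) | bit_prox (euclid_bits n a b) j i)
     nth 0 (euclid_mults n a b) j <= nth 0 (euclid_mults n a b) i)%N.
Proof.
elim: n a b i => [|n IH] a b i.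
  by rewrite big_mkcond /= big_nat1 /bit_prox ltn0.
have rec e0 a' b' m :
  (run_sum (~~ e0) (euclid_bits n a' b') (euclid_mults n a' b') <= m)%N ->
  (\sum_(0 <= j < (size (euclid_mults n a' b')).+1
         | bit_prox (e0 :: euclid_bits n a' b') j i)
     nth 0 (m :: euclid_mults n a' b') j <= nth 0 (m :: euclid_mults n a' b') i)%N.
  move=> hm; rewrite big_mkcond big_nat_recl // {1}/bit_prox /= add0n.
  case: i => [|i].
    rewrite -big_mkcond; apply: leq_trans hm; rewrite run_sumE ?size_euclid_mults //.
    rewrite big_nat_cond [X in (_ <= X)%N]big_nat_cond.
    rewrite (eq_bigl (fun j => (0 <= j < (size (euclid_bits n a' b')).+1)%N &&
      all (pred1 (~~ e0)) (take j (euclid_bits n a' b')))) //.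
    move=> j /=; case: ltnP => //= js; rewrite bit_prox_cons0 //.
  rewrite (eq_bigr (fun j => if bit_prox (euclid_bits n a' b') j i
    then nth 0%N (euclid_mults n a' b') j else 0%N)).
    by rewrite -big_mkcond; apply: IH.
  by move=> j _; rewrite bit_prox_consS.
rewrite /=; case: ltnP => [ab|ba].
  exact/rec/(run_sum_euclid false n a (b - a)).
case: ltnP => [ba'|ab].
  exact/rec/(run_sum_euclid true n (a - b) b).
by rewrite big_mkcond /= big_nat1 /bit_prox ltn0.
Qed.

Lemma sumn_take_le (M n : nat) s : all (fun m => m <= M)%N s ->
  (sumn (take n s) <= n * M)%N.
Proof.
elim: s n => [|x s IH] [|n] //= /andP[xM sM].
by rewrite mulSn leq_add // IH.
Qed.

Definition euclid_weights (k n a b : nat) : 'I_(size (euclid_bits n a b)).+1 -> nat :=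
  fun i => (k * nth 0 (euclid_mults n a b) i)%N.

Arguments euclid_weights : clear implicits.

Lemma sum_euclid_weights (f : nat -> nat) (k n a b : nat) :
  (\sum_i f (euclid_weights k n a b i) = \sum_(m <- euclid_mults n a b) f (k * m))%N.
Proof.
rewrite (big_nth 0%N) size_euclid_mults big_mkord.
by apply: eq_bigr.
Qed.

Lemma euclid_weights_prox (C : fieldType) k n a b (r : pplane C) c :
  proximity_inequalities (chain (euclid_bits n a b) r c) (euclid_weights k n a b).
Proof.
move=> i; rewrite /euclid_weights -big_distrr leq_mul2l.
apply/orP; right; apply: leq_trans (euclid_proximity n a b i).
rewrite size_euclid_mults big_mkord leq_eqVlt; apply/orP; left; apply/eqP.
by apply: eq_bigl => j; rewrite proximate_chain.
Qed.

Lemma euclid_weights_top3 k n a b :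
  (sumn (take 3 (sort geq (codom (euclid_weights k n a b)))) <= 3 * (k * a))%N.
Proof.
apply: sumn_take_le; rewrite all_sort; apply/allP => _ /codomP[i ->].
rewrite leq_mul2l (allP (euclid_mults_le n a b)) ?orbT //.
by rewrite mem_nth // size_euclid_mults.
Qed.

(** The virtual dimension is not positive: the linear terms of the
    m (m + 1) / 2 may be dropped, since (d+1)(d+2) <= (d+2)^2. *)
Lemma euclid_weights_dim k n a b d : (0 < a)%N -> (0 < b)%N -> (a + b <= n)%N ->
  (d.+2 ^ 2 <= k ^ 2 * (a * b))%N ->
  ((d.+1 * d.+2)./2 <=
     \sum_i (euclid_weights k n a b i * (euclid_weights k n a b i).+1)./2)%N.
Proof.
move=> a0 b0 abn hd.
rewrite (sum_euclid_weights (fun m => (m * m.+1)./2)).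
apply: (@leq_trans (k ^ 2 * (a * b))./2).
  by rewrite half_leq // (leq_trans _ hd) //; nia.
rewrite -(euclid_mults_sq a0 b0 abn) big_distrr /=.
elim: (euclid_mults n a b) => [|m M IH]; first by rewrite !big_nil.
rewrite !big_cons; apply: leq_trans (leq_add (leqnn _) IH).
have : (k ^ 2 * m ^ 2 <= (k * m) * (k * m).+1)%N by nia.
have : ~~ odd ((k * m) * (k * m).+1) by rewrite oddM /= andbN.
set A := ((k * m) * _)%N; lia.
Qed.

(** * Polynomials of large value are sections *)

Section Pullback.
Variable C : fieldType.
Local Notation poly2 := {mpoly C[2]}.
Implicit Types (f g : poly2) (c : nat -> C) (d : direction C).

(** [jet0] and [shear] are the jet and the coordinate change for a series without
    constant term, in a form that suits the recursion [jet0S]: a blowup shifts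
    the coefficients. *)
Definition jet0 c (N : nat) : poly2 := \sum_(l < N) c l.+1 *: varx ^+ l.+1.

Lemma comp2_jet0 c N (p q : poly2) :
  jet0 c N \mPo [tuple p; q] = \sum_(l < N) c l.+1 *: p ^+ l.+1.
Proof.
rewrite raddf_sum; apply: eq_bigr => l _ /=.
by rewrite comp_mpolyZ rmorphXn /= comp2X.
Qed.

Lemma jet0S c N :
  jet0 c N.+1 = varx * (jet0 (fun l => c l.+1) N + (c 1%N)%:MP).
Proof.
rewrite /jet0 big_ord_recl expr1 mulrDr addrC; congr (_ + _); last first.
  by rewrite mulrC mul_mpolyC.
rewrite mulr_sumr; apply: eq_bigr => l _.
by rewrite -scalerAr -exprS.
Qed.

Lemma wfilt_jet0 (W : realDomainType) (a b M : W) c N : 0 <= a -> M <= a ->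
  wfilt a b M (jet0 c N).
Proof.
move=> a0 aM; apply: wfilt_sum => l _; apply: wfiltZ.
apply: (@wfiltW _ _ _ _ (a * l.+1%:R)); last exact/wfiltXn/wfiltX.
by apply: (le_trans aM); rewrite ler_peMr // ler1n.
Qed.

Definition shear c N f : poly2 := f \mPo [tuple varx; vary + jet0 c N].

Lemma shearK c N f : shear c N f \mPo [tuple varx; vary - jet0 c N] = f.
Proof.
by rewrite /shear comp2A comp_mpolyD comp2_jet0 comp2X comp2Y subrK comp2_id.
Qed.

(** If y weighs at most as much as x, the change y -> y + jet preserves the
    weight filtration. *)
Lemma wfilt_shearE (W : realDomainType) (a b M : W) c N f :
  0 <= a -> b <= a -> wfilt a b M (shear c N f) -> wfilt a b M f.
Proof.
move=> a0 ba h; rewrite -(shearK c N f); apply: wfilt_comp h.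
  exact: wfiltX.
by apply: wfiltB; [exact: wfiltY|exact: wfilt_jet0].
Qed.

Lemma blowup_chartE d : exists p q : poly2,
  blowup_chart d = [tuple exceptional d * p; exceptional d * q].
Proof.
case: d => [x|]; [exists 1, (vary + x%:MP)|exists varx, 1].
  by rewrite mulr1.
by rewrite mulr1 mulrC.
Qed.

Lemma blowup_factor f d n : wfilt (1 : int) 1 n%:R f ->
  exists g, f \mPo blowup_chart d = exceptional d ^+ n * g.
Proof. by have [p [q ->]] := blowup_chartE d; apply: comp2_factor. Qed.

(** The product of the total transforms of the exceptional divisors over the
    successive points of the chain s, with multiplicities ms, in the last
    chart. *)
Fixpoint exc_prod (s : seq (direction C)) (ms : seq nat) : poly2 :=
  match s, ms with
  | d :: r, m :: ms' => pullback r (exceptional d) ^+ m * exc_prod r ms'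
  | _, _ => 1
  end.

Lemma pullbackM s f g : pullback s (f * g) = pullback s f * pullback s g.
Proof. by elim: s f g => [|d s IH] f g //=; rewrite rmorphM IH. Qed.

Lemma pullbackXn s f n : pullback s (f ^+ n) = pullback s f ^+ n.
Proof. by elim: s f => [|d s IH] f //=; rewrite rmorphXn IH. Qed.

(** A monomial of weight at least k a b has degree at least
    k a b / max(a, b) = k min(a, b). *)
Lemma wfilt_order k a b f : (0 < a)%N -> (0 < b)%N ->
  wfilt (a%:R : int) b%:R (k * (a * b))%:R f ->
  wfilt (1 : int) 1 (k * minn a b)%:R f.
Proof.
move=> a0 b0 h m /h hm; rewrite !mul1r -natrD ler_nat.
move: hm; rewrite -(natrM _ a) -(natrM _ b) -natrD ler_nat => hm.
have [ab|ba] := leqP a b; nia.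
Qed.

(** With h = x (c_1 + h'), substituting y -> y + h before the monomial map
    (x, x y) is substituting (x, x (y + c_1)) before y -> y + h'. *)
Lemma shear_blowup_some c N f g n :
  f \mPo blowup_chart (Some (c 1%N)) = varx ^+ n * g ->
  varx ^+ n * shear (fun l => c l.+1) N g =
  shear c N.+1 f \mPo [tuple varx; varx * vary].
Proof.
move=> e; rewrite /shear comp2A comp_mpolyD comp2X comp2Y comp2_jet0.
have -> : varx ^+ n * (g \mPo [tuple varx; vary + jet0 (fun l => c l.+1) N]) =
   (varx ^+ n * g) \mPo [tuple varx; vary + jet0 (fun l => c l.+1) N].
  by rewrite rmorphM rmorphXn /= comp2X.
rewrite -e /= comp2A comp2X; congr (f \mPo [tuple _; _]).
rewrite rmorphM /= comp_mpolyD comp2X comp2Y comp_mpolyC -addrA mulrDr.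
by rewrite -jet0S.
Qed.

(** Induction on the Euclidean algorithm.  The weight condition k a b in the
    weights (a, b) forces order k min(a, b), so that the blowup splits off the
    k min(a, b)-th power of the exceptional equation, and the cofactor satisfies
    the same condition for the new weights: for a < b,
    k a b - a (k a) = k a (b - a).  The bound b <= a (N+1) ensures that the
    degrees beyond the jet are heavier than y, hence immaterial. *)
Lemma pullback_chain n a b k c N f : (0 < a)%N -> (0 < b)%N ->
  (b <= a * N.+1)%N ->
  wfilt (a%:R : int) b%:R (k * (a * b))%:R (shear c N f) ->
  forall i d, (i <= size (euclid_bits n a b))%N ->
  let s := rcons (take i (dirs (euclid_bits n a b) c)) d in
  exists g, pullback s f = g * exc_prod s (map (muln k) (euclid_mults n a b)).
Proof.
elim: n a b c N f => [|n IH] a b c N f a0 b0 bN hf i d hi s.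
- move: hi; rewrite /s leqn0 => /eqP -> /=; rewrite mulr1.
  have [|g ->] := @blowup_factor f d (k * minn a b).
    apply: (@wfilt_shearE _ _ _ _ c N) => //; exact: wfilt_order hf.
  by exists g; rewrite mulrC.
have ford : wfilt (1 : int) 1 (k * minn a b)%:R f.
  by apply: (@wfilt_shearE _ _ _ _ c N) => //; exact: wfilt_order hf.
case: i hi @s => [_|i hi] /=.
  rewrite take0 /=; have [g ->] := @blowup_factor f d _ ford.
  by exists g; rewrite mulr1 mulrC.
have : (i.+1 <= size (euclid_bits n.+1 a b))%N by [].
rewrite /=; case: (ltnP a b) => [ab|ba] /=.
  move=> his.
  case: N bN hf => [|N] bN hf; first by lia.
  rewrite (minn_idPl (ltnW ab)) in ford.
  have [g hg] := @blowup_factor f (Some (c 1%N)) _ ford.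
  have [|||//|g' e] := IH a (b - a)%N (fun l => c l.+1) N g _ _ _ _ i d his => //.
  - by rewrite subn_gt0.
  - by rewrite leq_subLR -mulnS.
  - apply: (@wfilt_divX _ _ _ _ (k * (a * b))%:R _ (k * a)).
      by rewrite -natrM -natrD ler_nat; nia.
    rewrite (shear_blowup_some N hg); apply: wfilt_comp hf; first exact: wfiltX.
    have {1}-> : b%:R = a%:R + (b - a)%:R :> int by rewrite -natrD subnKC // ltnW.
    by apply: wfiltM; [exact: wfiltX|exact: wfiltY].
  exists g'; rewrite hg /= pullbackM pullbackXn e mulrCA.
  by [].
case: (ltnP b a) => [ba'|ab] //= his.
rewrite (minn_idPr ba) in ford.
have [g hg] := @blowup_factor f None _ ford.
have [|||//|g' e] := IH (a - b)%N b (fun=> 0) b g _ _ _ _ i d his => //.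
- by rewrite subn_gt0.
- by nia.
- have -> : shear (fun=> 0) b g = g.
    by rewrite /shear /jet0 big1 ?addr0 ?comp2_id // => l _; rewrite scale0r.
  have hf' : wfilt (a%:R : int) b%:R (k * (a * b))%:R f.
    by apply: wfilt_shearE hf; rewrite ?ler_nat.
  apply: (@wfilt_divY _ _ _ _ (k * (a * b))%:R _ (k * b)).
    by rewrite -natrM -natrD ler_nat; nia.
  rewrite -hg /=; apply: wfilt_comp hf'; last exact: wfiltY.
  have {1}-> : a%:R = (a - b)%:R + b%:R :> int by rewrite -natrD subnK.
  by apply: wfiltM; [exact: wfiltX|exact: wfiltY].
by exists g'; rewrite hg /= pullbackM pullbackXn e mulrCA.
Qed.

Lemma exc_prodE (s : seq (direction C)) (ms : seq nat) :
  exc_prod s ms = \prod_(j < size ms)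
    (if (j < size s)%N then pullback (drop j.+1 s) (exceptional (nth None s j))
     else 1) ^+ nth 0%N ms j.
Proof.
elim: ms s => [|m ms IH] [|d s] /=; rewrite ?big_ord0 //.
  by rewrite big1 // => j _; rewrite expr1n.
rewrite big_ord_recl /= drop0; congr (_ * _).
by rewrite IH; apply: eq_bigr => j _.
Qed.

Lemma total_exceptional_chain s (r : pplane C) c i d (j : 'I_(size s).+1) :
  (i <= size s)%N ->
  let w := rcons (take i (dirs s c)) d in
  total_exceptional (chain s r c j) (r, w) =
  if (j < size w)%N then pullback (drop j.+1 w) (exceptional (nth None w j))
  else 1.
Proof.
move=> is_ w; have sz : size w = i.+1 by rewrite size_rcons size_takel ?size_dirs.
have js : (j <= size (dirs s c))%N by rewrite size_dirs -ltnS.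
rewrite /total_exceptional /precedes /chain /= eqxx /= size_takel //.
case: (ltnP j (size w)) => jw; last by rewrite andbF.
rewrite andbT.
have ji : (j <= i)%N by rewrite -ltnS -sz.
rewrite prefixE size_takel // /w -cats1 takel_cat ?size_takel ?size_dirs //.
rewrite take_takel // eqxx cats1 -/w.
by rewrite (drop_nth None jw).
Qed.

(** The form whose restriction to the affine chart centered at ab is f: the
    homogenization of f(x - ab.1, y - ab.2), as a sum over the monomials of
    f. *)
Definition homogenize (ab : C * C) (d : nat) f : {mpoly C[3]} :=
  \sum_(m <- msupp f) f@_m *: ('X_0 ^+ (d - mdeg m) *
     (('X_1 - ab.1 *: 'X_0) ^+ m 0 * ('X_(2 : 'I_3) - ab.2 *: 'X_0) ^+ m 1)).

Lemma homogenize_homog ab (d : nat) f : (msize f <= d.+1)%N ->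
  homogenize ab d f \is d.-homog.
Proof.
move=> fd; rewrite /homogenize big_seq; apply: rpred_sum => m mf.
have md : (mdeg m <= d)%N by rewrite -ltnS (leq_trans (msize_mdeg_lt mf)).
apply: rpredZ.
have e : (d = (d - mdeg m) + (m 0%R + m 1%R))%N.
  rewrite -[LHS](subnK md); congr addn.
  rewrite mdegE !big_ord_recl big_ord0 addn0.
  by rewrite (_ : lift ord0 ord0 = 1) //; apply: val_inj.
have X1 (i : 'I_3) : ('X_i : {mpoly C[3]}) \is 1.-homog by rewrite dhomogX /= mdeg1.
have Xn (p : {mpoly C[3]}) n : p \is 1.-homog -> p ^+ n \is n.-homog.
  by move=> hp; rewrite -{2}[n]mul1n; apply: dhomogMn.
rewrite {2}e; apply: dhomogM; first exact: Xn.
by apply: dhomogM; apply: Xn; rewrite rpredB ?rpredZ.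
Qed.

Lemma homogenizeK ab (d : nat) f :
  homogenize ab d f \mPo plane_chart (inl ab) = f.
Proof.
case: ab => a1 a2; rewrite /homogenize raddf_sum -[RHS]comp2_id comp2E.
apply: eq_bigr => m _ /=; rewrite comp_mpolyZ !rmorphM !rmorphXn.
rewrite !rmorphB /= !comp_mpolyZ !comp_mpolyXU /=.
by rewrite expr1n mul1r !alg_mpolyC !addrK.
Qed.

Lemma homogenize_eq0 ab (d : nat) f : homogenize ab d f = 0 -> f = 0.
Proof. by move=> h; rewrite -(homogenizeK ab d f) h raddf0. Qed.

(** At a point of the blowup that lies over no point of the chain the condition
    is void; every other one is reached from a point of the chain by one further
    direction, which is the case of [pullback_chain]. *)
Lemma homogenize_sections n a b k c N f ab (d : nat) : (0 < a)%N -> (0 < b)%N ->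
  (b <= a * N.+1)%N ->
  wfilt (a%:R : int) b%:R (k * (a * b))%:R (shear c N f) ->
  (msize f <= d.+1)%N ->
  sections (chain (euclid_bits n a b) (inl ab) c) (euclid_weights k n a b) d
    (homogenize ab d f).
Proof.
move=> a0 b0 bN hf fd; split; first exact: homogenize_homog.
move=> [r w] [Kw pw]; set s := euclid_bits n a b.
have [re|rne] := eqVneq r (inl ab); last first.
  exists 1, (form_at (r, w) (homogenize ab d f)).
  rewrite meval1 oner_neq0 mul1r big1 ?mulr1 // => j _.
  by rewrite /total_exceptional /precedes /= eq_sym (negPf rne) /= expr1n.
subst r; case/lastP: w Kw pw => [|w e] Kw pw.
  by case: (Kw ord0); rewrite /chain /= take0.
have [|j] := pw (inl ab, w).
  by rewrite /precedes eqxx /= prefix_rcons size_rcons ltnSn.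
rewrite /chain => -[we].
have js : (j <= size s)%N by rewrite -ltnS.
have [g hg] := @pullback_chain n a b k c N f a0 b0 bN hf j e js.
exists 1, g; rewrite meval1 oner_neq0 mul1r; split=> //.
rewrite /form_at /= homogenizeK -we hg; congr (_ * _).
rewrite exc_prodE size_map size_euclid_mults; apply: eq_bigr => l _.
rewrite (total_exceptional_chain (inl ab) c e l js).
congr (_ ^+ _); rewrite (nth_map 0%N) //.
by rewrite size_euclid_mults.
Qed.

End Pullback.

(** * Vanishing for very general series *)

Section Vanishing.
Variable R : realType.
Local Notation C := R[i].

Lemma straighten_shear (xi : nat -> C) n f : xi 0%N = 0 ->
  straighten xi n f = shear xi n f.
Proof.
move=> xi0; rewrite /straighten /shear /jet0 big_ord_recl xi0 scale0r add0r.
by [].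
Qed.

Lemma wfilt_rescale (C' : fieldType) (a b k : nat) (f : {mpoly C'[2]}) : (0 < a)%N ->
  wfilt (1 : R) (b%:R / a%:R) (k * b)%:R f ->
  wfilt (a%:R : int) b%:R (k * (a * b))%:R f.
Proof.
move=> a0 h m /h; rewrite mul1r => hm.
rewrite -(natrM _ a) -(natrM _ b) -natrD ler_nat -(ler_nat R).
have ha : 0 < a%:R :> R by rewrite ltr0n.
have := ler_wpM2l (ltW ha) hm.
rewrite mulrDr mulrA [a%:R * (_ / _)]mulrC divfK ?gt_eqF //.
by rewrite -!natrM -natrD mulnCA.
Qed.

(** Sufficient conditions for the conjecture to apply to k times the Euclidean
    multiplicities of (a, b) in degree d, and to predict no sections. *)
Definition admissible (q : nat * nat * nat * nat) : bool :=
  let '(a, b, k, d) := q in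
  [&& (0 < a)%N, (a < b)%N, (3 * (k * a) < d)%N
    & (d.+2 ^ 2 <= k ^ 2 * (a * b))%N].

Lemma admissible_vanishing a b k d : GLS_conjecture C -> admissible (a, b, k, d) ->
  exists N (Z : set ('I_N -> C)),
    [/\ zariski_closed Z, Z <> setT &
     forall xi : nat -> C, xi 0%N = 0 -> ~ Z (fun i => xi i.+1) ->
     forall f, f != 0 -> (msize f <= d.+1)%N ->
       ~ (k * b)%:R <= qm_val xi (b%:R / a%:R) f].
Proof.
move=> gls /and4P[a0 ab k3 hd]; have b0 : (0 < b)%N by apply: ltn_trans ab.
pose s := euclid_bits (a + b) a b.
have s0 : nth true s 0 by rewrite /s; case: (a + b)%N => [//|n] /=; rewrite ab.
have k0 : (0 < k)%N by case: k k3 hd => // _; rewrite expnS mul0n.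
have [] := @general_chain_sections C s (euclid_weights k (a + b) a b) d gls s0.
- exact: euclid_weights_prox.
- exact: leq_ltn_trans (euclid_weights_top3 _ _ _ _) k3.
- exact: euclid_weights_dim.
move=> p [Z [Zcl ZT hZ]]; exists (size s), Z; split=> // xi xi0 hxi f f0 fd hv.
move/eqP: (f0); apply; apply: (homogenize_eq0 (ab := p) (d := d)).
apply: (hZ _ hxi); apply: (@homogenize_sections _ _ _ _ _ _ (k * b)) => //.
  by nia.
apply: wfilt_rescale => //; rewrite -straighten_shear //.
by apply/le_qm_val => //; rewrite divr_ge0.
Qed.

End Vanishing.

(** * Limits *)

Section Limits.
Variable R : realType.
Local Notation C := R[i].

Lemma cvg_eps (u : nat -> R) (l : R) :
  (forall e : R, 0 < e -> exists D : nat, forall n, (D <= n)%N -> `|u n - l| <= e) ->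
  u @ \oo --> l.
Proof.
move=> h; apply/cvgrPdistC_le => e /h[D hD].
by exists D => // n /= /hD.
Qed.

Lemma exists_nat_ge (x : R) : exists D : nat, forall n, (D <= n)%N -> x <= n%:R.
Proof.
exists (Num.truncn x).+1 => n hn; apply/ltW/(lt_le_trans (truncnS_gt x)).
by rewrite ler_nat.
Qed.

(** For large n, the lattice point count differs from n^2 / (2t) by at most
    6 / n times n^2 / 2. *)
Lemma vol_qm (xi : nat -> C) (t : R) : 1 <= t -> vol (qm_val xi t) = t^-1.
Proof.
move=> t1; have t0 : 0 < t by apply: lt_le_trans t1.
apply: (@cvg_lim _ (@Rhausdorff R)); apply: cvg_eps => e e0.
have [D hD] := exists_nat_ge (Num.max (t + 1) (6 / e)).
exists D => n /hD; rewrite ge_max => /andP[nt ne]; rewrite colength_val_ideal //.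
have n0 : 0 < n%:R :> R by lra.
have := card_below_ge n t1; have := card_below_le n t1.
move: (#|_|%:R : R) (n%:R : R) nt ne n0 => N x xt xe x0 hN1 hN2.
rewrite ger0_norm; last first.
  rewrite subr_ge0 ler_pdivlMr; last by rewrite divr_gt0 ?exprn_gt0.
  by apply: le_trans hN2; rewrite le_eqVlt; apply/orP; left; apply/eqP; field; lra.
rewrite lerBlDr ler_pdivrMr; last by rewrite divr_gt0 ?exprn_gt0.
apply: (le_trans hN1); rewrite ler_pdivrMr ?mulr_gt0 //.
have -> : (e + t^-1) * (x ^+ 2 / 2) * (2 * t) = e * t * x ^+ 2 + x ^+ 2.
  by field; lra.
have h6 : 6 <= e * x by rewrite mulrC -ler_pdivrMr.
have : 6 * (t * x) <= e * x * (t * x) by rewrite ler_wpM2r // mulr_ge0 // ltW.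
have : (t + 1) ^+ 2 <= 2 * t * x by nra.
nra.
Qed.

Variables (t : R) (xi : nat -> C).
Hypothesis t9 : 9 <= t.
Hypothesis gen : forall a b k d, admissible (a, b, k, d) ->
  forall f, f != 0 -> (msize f <= d.+1)%N ->
    ~ (k * b)%:R <= qm_val xi (b%:R / a%:R) f.

Let v := qm_val xi t.
Let t0 : 0 < t. Proof. by apply: lt_le_trans t9; rewrite ltr0n. Qed.
Let t1 : 1 <= t. Proof. by apply: le_trans t9; rewrite ler1n. Qed.
Let s3 : 3 <= Num.sqrt t.
Proof.
rewrite -(ler_pXn2r (ltn0Sn 1)) ?nnegrE ?sqrtr_ge0 // sqr_sqrtr ?(ltW t0) //.
by rewrite -natrX.
Qed.

(** For f <> 0 the value grows with the slope. *)
Lemma qm_val_admissible a b k d : admissible (a, b, k, d) ->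
  t <= b%:R / a%:R -> forall f, f != 0 -> (msize f <= d.+1)%N ->
  v f <= (k * b)%:R.
Proof.
move=> ok tab f f0 fd; have h := gen ok f0 fd.
rewrite leNgt; apply/negP => /ltW hv; apply: h.
have b0 : 0 <= b%:R / a%:R :> R by rewrite divr_ge0.
move: hv; rewrite /v !le_qm_val // ?(ltW t0) // => hv m /hv /le_trans; apply.
by rewrite lerD2l ler_wpM2r.
Qed.

Lemma mu_le a b k d : admissible (a, b, k, d) ->
  t <= b%:R / a%:R -> mu v d <= (k * b)%:R.
Proof.
move=> ok tab; apply: ge_sup.
  by exists (v 1), 1 => //; split; [exact: oner_neq0|rewrite msize1].
by move=> _ [f [f0 fd] <-]; exact: (qm_val_admissible ok tab).
Qed.

Lemma mu_ge a b k d (M : nat) : admissible (a, b, k, d) ->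
  t <= b%:R / a%:R -> M%:R + t + 1 < Num.sqrt t * d.+1%:R ->
  M%:R <= mu v d.
Proof.
move=> ok tab hM.
have [|f [f0 fd hf]] := @exists_large_val R xi t M d t1.
  rewrite -(ltr_nat R); apply: (le_lt_trans (card_below_le M t1)).
  apply: (lt_le_trans _ (card_below_ge d.+1 (lexx 1))).
  rewrite mulr1 ltr_pdivrMr ?mulr_gt0 // mulrA divfK ?pnatr_eq0 //.
  have -> : d.+1%:R ^+ 2 * t = (Num.sqrt t * d.+1%:R) ^+ 2.
    by rewrite exprMn sqr_sqrtr ?(ltW t0) // mulrC.
  by rewrite ltr_pXn2r // ?nnegrE ?addr_ge0 ?(ltW t0) // mulr_ge0 ?sqrtr_ge0.
apply: (le_trans hf); apply: ub_le_sup; last by exists f.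
by exists (k * b)%:R => _ [g [g0 gd] <-]; exact: (qm_val_admissible ok tab).
Qed.

(** First b / a is chosen in ]t, t + sqrt t * e], so that its root s' is at most
    sqrt t + e / 2; then k is the least integer above (d + 2) / (a s'), where
    a s' = sqrt (a b).  Hence k b = (k a s') s' is d s' + O(1), and 3 k a < d for
    large d because s' > 3. *)
Lemma exists_admissible (e : R) : 0 < e -> exists D : nat, forall d, (D <= d)%N ->
  exists a b k, [/\ admissible (a, b, k, d), t <= b%:R / a%:R &
    (k * b)%:R <= d%:R * (Num.sqrt t + e)].
Proof.
move=> e0; set s := Num.sqrt t.
have s3' : 3 <= s by exact: s3.
have ss : s ^+ 2 = t by rewrite sqr_sqrtr // ltW.
have se : 0 < s * e by rewrite mulr_gt0 //; lra.
pose a := (Num.truncn (s * e)^-1).+1.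
have a0 : 0 < a%:R :> R by rewrite ltr0n.
have ha : 1 <= a%:R * (s * e).
  by rewrite -ler_pdivrMr // div1r; apply/ltW/truncnS_gt.
pose b := (Num.truncn (t * a%:R)).+1.
have hb1 : t * a%:R < b%:R by apply: truncnS_gt.
have hb2 : b%:R <= t * a%:R + 1.
  by rewrite /b -natr1 lerD2r truncn_le mulr_ge0 // ltW.
pose s' := Num.sqrt (b%:R / a%:R : R).
have tba : t < b%:R / a%:R by rewrite ltr_pdivlMr.
have ss' : s' ^+ 2 = b%:R / a%:R by rewrite sqr_sqrtr // divr_ge0.
have s'0 : 0 <= s' by rewrite sqrtr_ge0.
have s's : s < s' by rewrite ltr_sqrt // divr_gt0 // ltr0n.
have s'e : s' <= s + e / 2.
  rewrite -(ler_pXn2r (ltn0Sn 1)) ?nnegrE //; last by lra.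
  rewrite ss' ler_pdivrMr //; apply: (le_trans hb2).
  rewrite -ss; nra.
have bE : b%:R = a%:R * s' ^+ 2 :> R by rewrite ss' mulrC divfK // gt_eqF.
pose c1 : R := (6 + 3 * (a%:R * s')) / (s' - 3).
pose c2 : R := 2 * (2 * s' + a%:R * s' ^+ 2) / e.
have [D hD] := exists_nat_ge (Num.max (c1 + 1) c2).
exists D => d /hD; rewrite ge_max => /andP[d1 d2].
pose k := (Num.truncn (d.+2%:R / (a%:R * s'))).+1.
have as0 : 0 < a%:R * s' by rewrite mulr_gt0 //; lra.
have hk1 : d.+2%:R <= k%:R * (a%:R * s').
  by rewrite -ler_pdivrMr //; apply/ltW/truncnS_gt.
have hk2 : k%:R * (a%:R * s') <= d.+2%:R + a%:R * s'.
  rewrite /k -natr1 mulrDl mul1r lerD2r -ler_pdivlMr // truncn_le.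
  by rewrite divr_ge0 // ltW.
have d2E : d.+2%:R = d%:R + 2 :> R by rewrite -addn2 natrD.
have s'3 : 0 < s' - 3 by lra.
exists a, b, k; split; [|exact: ltW|].
- apply/and4P; split => //.
  + rewrite -(ltr_nat R); apply: le_lt_trans hb1; exact: ler_peMl (ltW a0) t1.
  + have s'gt0 : 0 < s' by lra.
    rewrite -(ltr_nat R) !natrM -(ltr_pM2r s'gt0).
    have : 6 + 3 * (a%:R * s') < d%:R * (s' - 3).
      by rewrite -ltr_pdivrMr // (lt_le_trans _ d1) // /c1 ltrDl.
    rewrite -!mulrA; nra.
  + rewrite -(ler_nat R) natrM !natrX natrM bE.
    have -> : k%:R ^+ 2 * (a%:R * (a%:R * s' ^+ 2)) =
      (k%:R * (a%:R * s')) ^+ 2 :> R by ring.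
    by rewrite ler_pXn2r // nnegrE // mulr_ge0 // ltW.
- rewrite natrM bE expr2 [a%:R * _]mulrA mulrA.
  apply: (le_trans (ler_wpM2r s'0 hk2)); rewrite d2E.
  have : 2 * s' + a%:R * s' ^+ 2 <= d%:R * (e / 2).
    have : 2 * (2 * s' + a%:R * s' ^+ 2) <= d%:R * e by rewrite -ler_pdivrMr.
    lra.
  have : d%:R * s' <= d%:R * (s + e / 2) by rewrite ler_wpM2l.
  have -> : (d%:R + 2 + a%:R * s') * s' = d%:R * s' + (2 * s' + a%:R * s' ^+ 2) by ring.
  lra.
Qed.

Lemma mu_cvg : (fun d => mu v d / d%:R) @ \oo --> Num.sqrt t.
Proof.
apply: cvg_eps => e e0; have [D hD] := exists_admissible e0.
set s := Num.sqrt t in hD *.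
have s3' : 3 <= s by exact: s3.
have [D' hD'] := exists_nat_ge (Num.max (t + 3) ((t + 3) / e)).
exists (maxn D D').+1 => d hd.
have /hD[a [b [k [ok tab kb]]]] : (D <= d)%N by lia.
have : (D' <= d)%N by lia.
move=> /hD'; rewrite ge_max => /andP[dt de].
have d0 : 0 < d%:R :> R by rewrite ltr0n; lia.
have d1E : d.+1%:R = d%:R + 1 :> R by rewrite -natr1.
rewrite ler_norml lerBrDr lerBlDr; apply/andP; split; last first.
  rewrite ler_pdivrMr // mulrC addrC; exact: le_trans (mu_le ok tab) kb.
rewrite ler_pdivlMr //.
pose x := s * d.+1%:R - t - 2.
have x0 : 0 <= x by rewrite /x d1E; nra.
have hM : (Num.truncn x)%:R <= x by rewrite truncn_le.
apply: (@le_trans _ _ (Num.truncn x)%:R); last first.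
  by apply: (mu_ge ok tab); rewrite -/s; move: hM; rewrite /x; lra.
have : x < (Num.truncn x)%:R + 1 by rewrite natr1; apply: truncnS_gt.
have : t + 3 <= d%:R * e by rewrite -ler_pdivrMr.
rewrite /x d1E; nra.
Qed.

End Limits.

Theorem proposition4p2 (R : realType) (hGLS : GLS_conjecture R[i])
    (t : R) (ht : 9 <= t) :
  for_very_general_series (fun xi : nat -> R[i] =>
    minimal (qm_val xi t) /\ muhat (qm_val xi t) = Num.sqrt t).
Proof.
pose P q (p : {N : nat & set ('I_N -> R[i])}) :=
  [/\ zariski_closed (projT2 p), projT2 p <> setT &
    admissible q -> let '(a, b, k, d) := q in
    forall xi : nat -> R[i], xi 0%N = 0 -> ~ projT2 p (fun i => xi i.+1) ->
     forall f, f != 0 -> (msize f <= d.+1)%N ->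
       ~ (k * b)%:R <= qm_val xi (b%:R / a%:R) f].
have exP q : exists p, P q p.
  case ok: (admissible q); last first.
    exists (existT _ 0%N set0); split=> //=; last by rewrite ok.
      exists [set 1]; apply/seteqP; split=> x //= /(_ 1 erefl).
      by rewrite meval1 => /eqP; rewrite oner_eq0.
    by move=> /seteqP[_ /(_ (fun=> 0) I)].
  case: q ok => -[[a b] k] d ok.
  have [N [Z [Zcl ZT hZ]]] := admissible_vanishing hGLS ok.
  by exists (existT _ N Z).
have [h hP] := choice exP.
pose q n : nat * nat * nat * nat := odflt (0, 0, 0, 0)%N (unpickle n).
exists (fun n => projT1 (h (q n))), (fun n => projT2 (h (q n))); split.
  by move=> n; have [] := hP (q n).
move=> xi xi0 hxi.
have cv : (fun d => mu (qm_val xi t) d / d%:R) @ \oo --> Num.sqrt t.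
  apply: mu_cvg => // a b k d ok.
  have := hxi (pickle (a, b, k, d)); rewrite /q pickleK /= => hn.
  by have [_ _ /(_ ok)/(_ xi xi0 hn)] := hP (a, b, k, d).
have muE : muhat (qm_val xi t) = Num.sqrt t.
  by apply: (@cvg_lim _ (@Rhausdorff R)).
split=> //; split; first by apply/cvg_ex; exists (Num.sqrt t).
rewrite muE vol_qm; last by apply: le_trans ht; rewrite ler1n.
by rewrite sqrtrV ?(le_trans _ ht) // div1r invrK.
Qed.
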